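(* Let $n\ge 3$ and let $\mathcal{C}$ and $\mathcal{B}$ be maximal (by inclusion) collections of pairwise weakly separated $3$-subsets of $[1\dots n]$. Then there is a sequence of $(2,4)$-moves transforming $\mathcal{C}$ into $\mathcal{B}$.
   Context: Notation: $[1\dots n]=\{1,\dots,n\}$; $X-Y$ is set difference. For sets of integers write $X\prec Y$ if $x<y$ for all $x\in X$, $y\in Y$ (vacuously true if one is empty). Two $k$-subsets $I,J$ of $[1\dots n]$ are weakly separated if at least one of the following holds: (1) $J-I$ can be partitioned as $J'\sqcup J''$ with $J'\prec I-J\prec J''$; (2) $I-J$ can be partitioned as $I'\sqcup I''$ with $I'\prec J-I\prec I''$. (Parts may be empty.) $(2,4)$-move: let $\mathcal{C}$ be a maximal collection of pairwise weakly separated $k$-subsets of $[1\dots n]$, and suppose $I\cup\{i,s\}$, $I\cup\{s,j\}$, $I\cup\{j,t\}$, $I\cup\{i,t\}\in\mathcal{C}$ for some $i<s<j<t$ and some $I\subset[1\dots n]-\{i,j,s,t\}$ with $|I|=k-2$. Then $\mathcal{C}$ contains exactly one of $I\cup\{i,j\}$ and $I\cup\{s,t\}$, and the $(2,4)$-move replaces that set in $\mathcal{C}$ by the other one; the result is again a maximal collection of pairwise weakly separated $k$-subsets. (Here $k=3$, so $|I|=1$.) The sequence of moves may be empty. *)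

(* Defs.v *)
From mathcomp Require Import all_boot.

Set Implicit Arguments.
Unset Strict Implicit.
Unset Printing Implicit Defensive.

(* The ground set [1...n] is represented by 'I_n = {0, ..., n-1}, with m + 1
   encoded as m; only the order of the elements matters below. *)

Definition prec (n : nat) (X Y : {set 'I_n}) : bool :=
  [forall x in X, forall y in Y, x < y].

Definition surrounds (n : nat) (I J : {set 'I_n}) : bool :=
  [exists J1 : {set 'I_n}, exists J2 : {set 'I_n},
    [&& J1 :|: J2 == J :\: I, [disjoint J1 & J2],
        prec J1 (I :\: J) & prec (I :\: J) J2]].

Definition weakly_separated (n : nat) (I J : {set 'I_n}) : bool :=
  surrounds I J || surrounds J I.

Definition ws_collection (n k : nat) (C : {set {set 'I_n}}) : bool :=
  [forall I in C, #|I| == k] &&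
  [forall I in C, forall J in C, weakly_separated I J].

Definition max_ws_collection (n k : nat) (C : {set {set 'I_n}}) : bool :=
  maxset (@ws_collection n k) C.

(* The two disjuncts are the two directions of the move. At most one of them
   applies for given I, i, s, j, t, because I :|: [set i; j] and
   I :|: [set s; t] are not weakly separated. *)
Definition move24 (n k : nat) (C D : {set {set 'I_n}}) : bool :=
  max_ws_collection k C &&
  [exists I : {set 'I_n}, exists i : 'I_n, exists s : 'I_n,
   exists j : 'I_n, exists t : 'I_n,
    [&& [&& i < s, s < j & j < t],
        I \subset ~: [set i; j; s; t],
        #|I| + 2 == k,
        [&& I :|: [set i; s] \in C, I :|: [set s; j] \in C,
            I :|: [set j; t] \in C & I :|: [set i; t] \in C] &
        (I :|: [set i; j] \in C) &&
          (D == (I :|: [set s; t]) |: (C :\ (I :|: [set i; j])))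
        || (I :|: [set s; t] \in C) &&
          (D == (I :|: [set i; j]) |: (C :\ (I :|: [set s; t])))]].

(* Main.v *)
Require Import Defs.
From mathcomp Require Import all_boot zify.

Set Implicit Arguments.
Unset Strict Implicit.
Unset Printing Implicit Defensive.

(** Two 3-subsets are weakly separated exactly when they do not cross, that is,
    when no two points of I \ J are separated on the circle by two points of
    J \ I ([weakly_separatedE]).  A maximal collection thus becomes a maximal
    family of pairwise non-crossing triples, a notion invariant under rotations
    and reflections of the circle.

    Connectedness is proved by removing the points from the last one down.  Let
    m be the last point, and let L be the graph on the other points whose edges
    are the pairs ab with abm in the collection; it is drawn without crossings
    inside the polygon 0, 1, ..., m-1.  The edges 01, 0(m-1) and (m-2)(m-1) are
    always present, because the corresponding triples are cyclic intervals and
    cross nothing.  If L has no other edge, then the triples avoiding m form a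
    maximal family on m points, and one proceeds by induction.  Otherwise some
    move lowers the number of edges of L: there are a vertex e and neighbours
    b < a < c of e in L such that eba and eac are in the collection, and the
    move replaces eam by ebc ([nontrivial_exchange]).  As moves are reversible
    ([move24_sym]) and only one collection remains when three points are left
    ([reduced3_sub]), any two maximal collections are connected.

    The existence of such e, a, b, c rests on a local property of maximal
    families ([consecutive]): if uvx and uvy belong to the family and no uvz
    does for z between x and y, then uxy or vxy belongs to it.  For the neighbours
    x < y of a vertex u in L that are consecutive, this (with v = m) says that
    uxy is in the family or xy is an edge of L.  In the first case there is a
    third neighbour of u, beyond x or y, that completes an exchange
    ([exchange_right], [exchange_left]); repeated use of the second case leads
    to a triangle of L without further edges inside it, whose vertices form a
    triple of the family ([triangle_in]), and the first case applies again.
    The edge of L around which all this takes place is one of minimal span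
    among those that have a further edge below them ([chord_exchange]).

    All these arguments show that a given triple does not cross any triple of
    the family, knowing some members of the family.  Each such step is a
    statement about the relative order of finitely many numbers, and is decided
    by going through all their weak orderings ([order_decide]). *)

(** * Crossing of finite sets of points on a circle *)

(** For p, q distinct from r, s: exactly one of r, s lies between p and q, so
    that the chords pq and rs of the circle cross.  Being a parity of four
    comparisons, it is visibly invariant under rotations. *)
Definition separates (p q r s : nat) : bool :=
  (p < r) (+) (q < r) (+) (p < s) (+) (q < s).

Definition cross (A B : seq nat) : bool :=
  has (fun p => has (fun q => has (fun r => has (fun s =>
    [&& p \notin B, q \notin B, r \notin A, s \notin A & separates p q r s])
    B) B) A) A.

(** * Deciding statements about the relative order of finitely many numbers *)

(** Formulas about the order of points, which are referred to by their index in
    a list of numbers.  Crossing is a constructor so that a goal is convertible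
    to the value of a formula; [oexpand] then unfolds it to comparisons. *)
Inductive oform :=
  | OCst of bool
  | OLt of nat & nat
  | OLe of nat & nat
  | OEq of nat & nat
  | ONot of oform
  | OAnd of oform & oform
  | OOr of oform & oform
  | OXor of oform & oform
  | OImp of oform & oform
  | OCross of nat & nat & nat & nat & nat & nat.

Fixpoint oeval (v : seq nat) (f : oform) : bool :=
  match f with
  | OCst b => b
  | OLt i j => nth 0 v i < nth 0 v j
  | OLe i j => nth 0 v i <= nth 0 v j
  | OEq i j => nth 0 v i == nth 0 v j
  | ONot f => ~~ oeval v f
  | OAnd f g => oeval v f && oeval v g
  | OOr f g => oeval v f || oeval v g
  | OXor f g => oeval v f (+) oeval v g
  | OImp f g => oeval v f ==> oeval v g
  | OCross a b c x y z =>
      cross [:: nth 0 v a; nth 0 v b; nth 0 v c]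
            [:: nth 0 v x; nth 0 v y; nth 0 v z]
  end.

Definition ocross_pair (a b c p q r s : nat) : oform :=
  let out r := ONot (OOr (OEq r a) (OOr (OEq r b) (OEq r c))) in
  OAnd (out r) (OAnd (out s)
    (OXor (OLt p r) (OXor (OLt q r) (OXor (OLt p s) (OLt q s))))).

(** As [separates] is symmetric in both pairs, it is enough to consider three
    pairs on each side instead of the nine ordered ones. *)
Definition ocross (a b c x y z : nat) : oform :=
  let out p := ONot (OOr (OEq p x) (OOr (OEq p y) (OEq p z))) in
  let sep p q := OAnd (out p) (OAnd (out q)
    (OOr (ocross_pair a b c p q x y)
      (OOr (ocross_pair a b c p q x z) (ocross_pair a b c p q y z)))) in
  OOr (sep a b) (OOr (sep a c) (sep b c)).

Fixpoint oexpand (f : oform) : oform :=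
  match f with
  | ONot f => ONot (oexpand f)
  | OAnd f g => OAnd (oexpand f) (oexpand g)
  | OOr f g => OOr (oexpand f) (oexpand g)
  | OXor f g => OXor (oexpand f) (oexpand g)
  | OImp f g => OImp (oexpand f) (oexpand g)
  | OCross a b c x y z => ocross a b c x y z
  | _ => f
  end.

Lemma separatesC p q r s : separates q p r s = separates p q r s.
Proof.
by rewrite /separates; case: (p < r) (q < r) (p < s) (q < s) => [] [] [] [].
Qed.

Lemma separatesCr p q r s : separates p q s r = separates p q r s.
Proof.
by rewrite /separates; case: (p < r) (q < r) (p < s) (q < s) => [] [] [] [].
Qed.

Lemma separatesxx p r s : separates p p r s = false.
Proof. by rewrite /separates; case: (p < r) (p < s) => [] []. Qed.

Lemma separatesxxr p q r : separates p q r r = false.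
Proof. by rewrite /separates; case: (p < r) (q < r) => [] []. Qed.

Lemma has_pairs3 (P : nat -> nat -> bool) a b c :
    (forall x y, P x y = P y x) -> (forall x, P x x = false) ->
  has (fun p => has (P p) [:: a; b; c]) [:: a; b; c] =
  [|| P a b, P a c | P b c].
Proof.
move=> PC Pxx; rewrite /= !Pxx (PC b a) (PC c a) (PC c b).
by case: (P a b) (P a c) (P b c) => [] [] [].
Qed.

Lemma oeval_cross v a b c x y z :
  oeval v (ocross a b c x y z) = oeval v (OCross a b c x y z).
Proof.
rewrite -[RHS]/(cross [:: nth 0 v a; nth 0 v b; nth 0 v c]
            [:: nth 0 v x; nth 0 v y; nth 0 v z]) /=.
move: (nth 0 v a) (nth 0 v b) (nth 0 v c) (nth 0 v x) (nth 0 v y) (nth 0 v z).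
move=> {v} {}a {}b {}c {}x {}y {}z.
have E A B p q : has (fun r => has (fun s =>
    [&& p \notin B, q \notin B, r \notin A, s \notin A & separates p q r s])
    [:: x; y; z]) [:: x; y; z] =
    let P r s := [&& p \notin B, q \notin B, r \notin A, s \notin A
         & separates p q r s] in
    [|| P x y, P x z | P y z].
  rewrite has_pairs3 // => [r s|r]; last by rewrite separatesxxr !andbF.
  by rewrite (separatesCr p q s r) (andbCA (r \notin A)).
rewrite /cross has_pairs3; first last.
- by move=> p; rewrite E /= !separatesxx !andbF.
- by move=> p q; rewrite !E /= !(separatesC p q) !(andbCA (p \notin _)).
by rewrite !E /= !inE -!andb_orr /separates -!addbA.
Qed.

Lemma oeval_expand v f : oeval v (oexpand f) = oeval v f.
Proof.
elim: f => //= [f ->|f -> g ->|f -> g ->|f -> g ->|f -> g ->|a b c x y z] //.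
exact: (oeval_cross v a b c x y z).
Qed.

Definition as_const (f : oform) : option bool :=
  if f is OCst b then Some b else None.

(** Only the first [size e] points have been placed: [e] lists their ranks.
    Comparisons among them are evaluated, and what remains is the residual
    formula about the points still to be placed. *)
Fixpoint osimp (e : seq nat) (f : oform) : oform :=
  match f with
  | OLt i j => match onth e i, onth e j with
               | Some x, Some y => OCst (x < y)
               | _, _ => f
               end
  | OLe i j => match onth e i, onth e j with
               | Some x, Some y => OCst (x <= y)
               | _, _ => f
               end
  | OEq i j => match onth e i, onth e j with
               | Some x, Some y => OCst (x == y)
               | _, _ => f
               end
  | ONot f => let f' := osimp e f in
      if as_const f' is Some b then OCst (~~ b) else ONot f'
  | OAnd f g => let f' := osimp e f in
      match as_const f' with
      | Some b => if b then osimp e g else OCst false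
      | None => let g' := osimp e g in
          match as_const g' with
          | Some b => if b then f' else OCst false
          | None => OAnd f' g'
          end
      end
  | OOr f g => let f' := osimp e f in
      match as_const f' with
      | Some b => if b then OCst true else osimp e g
      | None => let g' := osimp e g in
          match as_const g' with
          | Some b => if b then OCst true else f'
          | None => OOr f' g'
          end
      end
  | OImp f g => let f' := osimp e f in
      match as_const f' with
      | Some b => if b then osimp e g else OCst true
      | None => let g' := osimp e g in
          match as_const g' with
          | Some b => if b then OCst true else ONot f'
          | None => OImp f' g'
          end
      end
  | OXor f g => let f' := osimp e f in let g' := osimp e g in
      match as_const f', as_const g' with
      | Some x, Some y => OCst (x (+) y)
      | _, _ => OXor f' g'
      end
  | _ => f
  end.

Lemma oeval_simp e v f :
    (forall i x j y, onth e i = Some x -> onth e j = Some y ->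
      ((x < y) = (nth 0 v i < nth 0 v j)) *
      ((x == y) = (nth 0 v i == nth 0 v j))) ->
  oeval v (osimp e f) = oeval v f.
Proof.
have constP h b : as_const h = Some b -> oeval v h = b by case: h => //= _ [->].
move=> ev.
elim: f => //= [i j|i j|i j|f <-|f <- g <-|f <- g <-|f <- g <-|f <- g <-].
1-3: case Ei: (onth e i) => [x|] //; case Ej: (onth e j) => [y|] //=;
     by rewrite ?(ev _ _ _ _ Ei Ej) // leq_eqVlt !(ev _ _ _ _ Ei Ej) -leq_eqVlt.
1: by case Ef: (as_const (osimp e f)) => [b|]; rewrite //= ?(constP _ _ Ef).
all: case Ef: (as_const (osimp e f)) => [b|].
all: try by rewrite (constP _ _ Ef); case: b {Ef}.
all: case Eg: (as_const (osimp e g)) => [c|]; rewrite //= ?(constP _ _ Ef).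
all: rewrite (constP _ _ Eg) //; case: c {Eg}.
all: by rewrite ?andbT ?andbF ?orbT ?orbF ?implybT ?implybF.
Qed.

(** The points already placed occupy the ranks below [k].  The next one either
    takes one of these ranks or a new rank [j], which shifts the ranks from [j]
    on.  Simplifying at every node cuts off most of the weak orderings, since
    violated hypotheses make the residual formula true. *)
Fixpoint ocheck (N k : nat) (e : seq nat) (f : oform) : bool :=
  let f' := osimp e f in
  match as_const f', N with
  | Some b, _ => b
  | None, N'.+1 =>
      all (fun j => ocheck N' k (rcons e j) f') (iota 0 k) &&
      all (fun j => ocheck N' k.+1 (rcons (map (bump j) e) j) f') (iota 0 k.+1)
  | None, 0 => false
  end.

(** The two ways to place a number [x] among the increasing values
    [f 0 < ... < f (k - 1)], matching the two branches of [ocheck]. *)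
Lemma rank_insert k (f : nat -> nat) x :
    {in gtn k &, {homo f : i j / i < j}} ->
  (exists2 j, j < k & f j = x) \/
  exists2 j, j <= k & exists g : nat -> nat, [/\ g j = x,
    {in gtn k, forall i, g (bump j i) = f i} &
    {in gtn k.+1 &, {homo g : i j / i < j}}].
Proof.
move=> f_incr.
have [/hasP[j] |no_j] := boolP (has (fun j => f j == x) (iota 0 k)).
  by rewrite mem_iota => ltj /eqP fj; left; exists j.
have f_neq i : i < k -> f i != x.
  move=> ltik; apply: contra no_j => fi; apply/hasP; exists i => //.
  by rewrite mem_iota.
right; have [] := @ex_minnP (fun j => (j == k) || (x < f j)) _.
  by exists k; rewrite eqxx.
move=> j jP j_min; have lejk: j <= k by apply: j_min; rewrite eqxx.
exists j => //.
exists (fun i => if i < j then f i else if i == j then x else f i.-1).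
have below i : i < j -> f i < x.
  move=> ltij; have := f_neq i (leq_trans ltij lejk).
  by rewrite neq_ltn => /orP[//|ltx]; have := j_min i; rewrite ltx orbT; lia.
have above i : j <= i -> i < k -> x < f i.
  move=> leji ltik; have [eqij|ltji] := eqVneq j i.
    by move: jP; rewrite eqij (ltn_eqF ltik).
  move: jP => /orP[|ltx]; first lia.
  by apply: ltn_trans ltx _; apply: f_incr; rewrite ?inE; lia.
split=> [|i _|i1 i2]; first by rewrite ltnn eqxx.
  rewrite /bump; case: (leqP j i) => [leji|ltij]; last by rewrite add0n ltij.
  by rewrite add1n ltnNge (leqW leji) /= gtn_eqF.
rewrite !inE => lti1 lti2 lt12.
have [lt1j|lej1] := ltnP i1 j; have [lt2j|lej2] := ltnP i2 j; last 2 first.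
- lia.
- case: ifP => [eq1|neq1]; (case: ifP => [eq2|neq2]; first lia).
    by apply: above; lia.
  by apply: f_incr; rewrite ?inE; lia.
- by apply: f_incr; rewrite ?inE; lia.
- case: ifP => [_|neq2]; first exact: below.
  by apply: f_incr; rewrite ?inE; lia.
Qed.

Lemma oeval_simp_ranks k (g : nat -> nat) e rest f :
    {in gtn k &, {homo g : i j / i < j}} -> all (gtn k) e ->
  oeval (map g e ++ rest) (osimp e f) = oeval (map g e ++ rest) f.
Proof.
move=> g_incr e_lt.
have val i x : onth e i = Some x -> x < k /\ nth 0 (map g e ++ rest) i = g x.
  move=> Ei; have lti : i < size e by rewrite -onthTE Ei.
  rewrite nth_cat size_map lti (nth_map 0) // (onth_nth 0 x e i Ei); split=> //.
  by rewrite -(onth_nth 0 x e i Ei); apply: (allP e_lt); apply: mem_nth.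
apply: oeval_simp => i x j y /val[ltx ->] /val[lty ->].
have [ltxy|ltyx|<-] := ltngtP x y; last by rewrite ltnn eqxx.
  by have := g_incr x y ltx lty ltxy; split; lia.
by have := g_incr y x lty ltx ltyx; split; lia.
Qed.

Lemma ocheck_sound N k (g : nat -> nat) e rest f :
    {in gtn k &, {homo g : i j / i < j}} -> all (gtn k) e -> size rest = N ->
    ocheck N k e f ->
  oeval (map g e ++ rest) f.
Proof.
elim: N k g e rest f => [|N IHN] k g e rest f g_incr e_lt sz_rest /=.
all: rewrite -(oeval_simp_ranks _ _ g_incr e_lt).
all: case Ef: (as_const _) => [b|] //.
1,2: by case: (osimp e f) Ef => // ? [->].
move: (osimp e f) => f' {Ef}.
case: rest sz_rest => // x rest [sz_rest] /andP[/allP eqC ltC].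
have {}ltC : {in iota 0 k.+1, forall j,
    ocheck N k.+1 (rcons (map (bump j) e) j) f'} by apply/allP.
have [[j ltj gj]|[j lej [g' [gj' gE g'_incr]]]] := rank_insert x g_incr.
  rewrite -cat_rcons -gj -map_rcons; apply: (IHN k) => //; last first.
    by apply: eqC; rewrite mem_iota.
  by rewrite all_rcons /= ltj.
rewrite -cat_rcons -gj'; have ->: map g e = map g' (map (bump j) e).
  by rewrite -map_comp; apply/eq_in_map => i /(allP e_lt) /gE.
rewrite -map_rcons; apply: (IHN k.+1) => //; last by apply: ltC; rewrite mem_iota.
rewrite all_rcons /= ltnS lej all_map; apply: sub_all e_lt => i /=.
by rewrite ltnS /bump; case: leqP; lia.
Qed.

Lemma ocheckP v f : ocheck (size v) 0 [::] (oexpand f) -> oeval v f.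
Proof. by rewrite -oeval_expand; apply: (@ocheck_sound _ _ id [::]). Qed.

(** The points are collected starting with the oldest hypothesis, so that the
    points whose order is known are placed first. *)
Ltac add_point x l :=
  lazymatch l with
  | context [cons x _] => l
  | _ => constr:(x :: l)
  end.

Ltac points_of b l :=
  lazymatch b with
  | leq (S ?x) ?y => let l := add_point x l in add_point y l
  | leq ?x ?y => let l := add_point x l in add_point y l
  | @eq_op _ ?x ?y => let l := add_point x l in add_point y l
  | negb ?b => points_of b l
  | andb ?b ?c => let l := points_of b l in points_of c l
  | orb ?b ?c => let l := points_of b l in points_of c l
  | implb ?b ?c => let l := points_of b l in points_of c l
  | cross [:: ?a; ?b; ?c] [:: ?x; ?y; ?z] =>
      let l := add_point a l in let l := add_point b l in
      let l := add_point c l in let l := add_point x l in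
      let l := add_point y l in add_point z l
  | true => l
  | false => l
  end.

Ltac index_of x l :=
  lazymatch l with
  | x :: _ => constr:(0)
  | _ :: ?l => let i := index_of x l in constr:(S i)
  end.

Ltac oform_of b l :=
  lazymatch b with
  | leq (S ?x) ?y =>
      let i := index_of x l in let j := index_of y l in constr:(OLt i j)
  | leq ?x ?y =>
      let i := index_of x l in let j := index_of y l in constr:(OLe i j)
  | @eq_op _ ?x ?y =>
      let i := index_of x l in let j := index_of y l in constr:(OEq i j)
  | negb ?b => let f := oform_of b l in constr:(ONot f)
  | andb ?b ?c =>
      let f := oform_of b l in let g := oform_of c l in constr:(OAnd f g)
  | orb ?b ?c =>
      let f := oform_of b l in let g := oform_of c l in constr:(OOr f g)
  | implb ?b ?c =>
      let f := oform_of b l in let g := oform_of c l in constr:(OImp f g)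
  | cross [:: ?a; ?b; ?c] [:: ?x; ?y; ?z] =>
      let a := index_of a l in let b := index_of b l in
      let c := index_of c l in let x := index_of x l in
      let y := index_of y l in let z := index_of z l in
      constr:(OCross a b c x y z)
  | true => constr:(OCst true)
  | false => constr:(OCst false)
  end.

(** Proves the goal from the boolean hypotheses of the context that are made of
    comparisons of numbers and crossings of explicit triples.  A successor
    counts as an unrelated point: facts such as [adjacent] below must be
    provided. *)
Ltac order_decide :=
  lazymatch goal with
  | |- False => apply: notF; change (is_true false)
  | _ => idtac
  end;
  repeat match goal with
  | H : is_true ?b |- is_true _ =>
      let l := points_of b constr:(@nil nat) in revert H; apply/implyP
  end;
  lazymatch goal with
  | |- is_true ?b =>
      let l := points_of b constr:(@nil nat) in
      let l := eval cbv [rev catrev] in (rev l) in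
      let f := oform_of b l in
      change (is_true (oeval l f)); apply: ocheckP; vm_compute; reflexivity
  end.



(** * Maximal non-crossing families of triples *)

Lemma cross_eq_mem A A' B B' : A =i A' -> B =i B' -> cross A B = cross A' B'.
Proof.
move=> eqA eqB; rewrite /cross (eq_has_r eqA); apply: eq_has => p.
rewrite (eq_has_r eqA); apply: eq_has => q.
rewrite (eq_has_r eqB); apply: eq_has => r.
by rewrite (eq_has_r eqB); apply: eq_has => s; rewrite !eqA !eqB.
Qed.

Lemma crossC A B : cross A B = cross B A.
Proof.
suff sub A1 B1 : cross A1 B1 -> cross B1 A1 by apply/idP/idP; apply: sub.
case/hasP=> p pA /hasP[q qA /hasP[r rB /hasP[s sB]]].
case/and5P=> pB qB rA sA sep.
apply/hasP; exists r => //; apply/hasP; exists s => //.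
apply/hasP; exists p => //; apply/hasP; exists q => //.
rewrite pB qB rA sA; move: sep pB qB; rewrite /separates.
have [<-|pr] := eqVneq r p; first by rewrite rB.
have [<-|ps] := eqVneq s p; first by rewrite sB.
have [<-|qr] := eqVneq r q; first by rewrite rB.
have [<-|qs] := eqVneq s q; first by rewrite sB.
by lia.
Qed.

(** [M a b c] means that the unordered triple of distinct points a, b, c < n
    belongs to the family. *)
Record max_system (n : nat) (M : nat -> nat -> nat -> bool) : Prop := MaxSystem {
  sysC12 : forall a b c, M a b c = M b a c;
  sysC23 : forall a b c, M a b c = M a c b;
  sys_lt : forall a b c, M a b c -> a < n;
  sys_neq : forall a b c, M a b c -> a != b;
  sys_nc : forall a b c x y z, M a b c -> M x y z ->
    ~~ cross [:: a; b; c] [:: x; y; z];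
  sys_max : forall a b c, a < n -> b < n -> c < n ->
    [&& a != b, a != c & b != c] ->
    (forall x y z, M x y z -> ~~ cross [:: x; y; z] [:: a; b; c]) -> M a b c
}.

Section MaxSystem.
Variables (n : nat) (M : nat -> nat -> nat -> bool).
Hypothesis sysM : max_system n M.

Let MC12 := sysC12 sysM.
Let MC23 := sysC23 sysM.
Lemma sysC13 a b c : M a b c = M c b a.
Proof. by rewrite MC12 MC23 MC12. Qed.

Lemma sys_rot a b c : M a b c = M b c a.
Proof. by rewrite MC12 MC23. Qed.

Lemma sys_lt3 a b c : M a b c -> c < n.
Proof. by rewrite sysC13; apply: sys_lt. Qed.

Lemma sys_sort a b c : M a b c ->
  exists x y z, [/\ x < y, y < z, M x y z & [:: x; y; z] =i [:: a; b; c]].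
Proof.
move=> Mabc; have := sys_neq sysM Mabc.
have := Mabc; rewrite sys_rot => /(sys_neq sysM).
have := Mabc; rewrite MC23 => /(sys_neq sysM).
rewrite !neq_ltn => ac bc ab.
have mem x y z :
    (forall t, [|| t == x, t == y | t == z] = [|| t == a, t == b | t == c]) ->
  [:: x; y; z] =i [:: a; b; c].
  by move=> E t; rewrite !inE.
have [ltab|leba] := ltnP a b; have [ltac|leca] := ltnP a c;
  have [ltbc|lecb] := ltnP b c; try lia.
- by exists a, b, c; split=> //; apply: mem => t; lia.
- by exists a, c, b; split; rewrite 1?MC23 //; try lia; apply: mem => t; lia.
- by exists c, a, b; split; rewrite 1?sys_rot //; try lia; apply: mem => t; lia.
- by exists b, a, c; split; rewrite 1?MC12 //; try lia; apply: mem => t; lia.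
- by exists b, c, a; split; rewrite -1?sys_rot //; try lia; apply: mem => t; lia.
- by exists c, b, a; split; rewrite 1?sysC13 //; try lia; apply: mem => t; lia.
Qed.

(** The form in which maximality is used throughout. *)
Lemma sys_blocked a b c : a < b -> b < c -> c < n -> ~~ M a b c ->
  exists x y z, [/\ x < y, y < z, M x y z & cross [:: x; y; z] [:: a; b; c]].
Proof.
move=> ltab ltbc ltcn nM; have ltbn := ltn_trans ltbc ltcn.
have [/existsP[x /existsP[y /existsP[z /andP[Mxyz X]]]]|noblock] :=
  boolP [exists x : 'I_n, exists y : 'I_n, exists z : 'I_n,
           M x y z && cross [:: x : nat; y : nat; z : nat] [:: a; b; c]].
  have [x' [y' [z' [lt1 lt2 M' E]]]] := sys_sort Mxyz.
  by exists x', y', z'; split; rewrite // (cross_eq_mem E (fun=> erefl)).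
case/negP: nM; apply: (sys_max sysM) => //; first exact: ltn_trans ltbn.
  by rewrite !ltn_eqF // (ltn_trans ltab).
move=> x y z Mxyz.
have ltx := sys_lt sysM Mxyz; have ltz := sys_lt3 Mxyz.
have lty : y < n by move: Mxyz; rewrite MC12; apply: sys_lt.
move: noblock; rewrite negb_exists => /forallP/(_ (Ordinal ltx)).
rewrite negb_exists => /forallP/(_ (Ordinal lty)).
rewrite negb_exists => /forallP/(_ (Ordinal ltz)) /=.
by rewrite Mxyz.
Qed.

(** * Consecutive completions of a pair *)

(** Suppose that vxy and uxy are both missing, hence crossed by triples T and S
    of the family.  As T and S do not cross uvx, uvy and each other, they have
    the form T = u t2 t3 and S = v s2 s3 with t2, t3, s2, s3 between x and y.
    Choose vpq in the family with x <= p < q < y and q as large as possible.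
    Then either uvq crosses nothing in the family, or the form of a triple R
    crossing it shows that p <> x and that uvp crosses nothing.  Both contradict
    that uvz is missing for all z between x and y. *)
Lemma consecutive_top u v x y :
    u < v -> v < x -> x < y -> y.+1 = n -> M u v x -> M u v y ->
    (forall z, x < z -> z < y -> ~~ M u v z) ->
  M u x y || M v x y.
Proof.
move=> ltuv ltvx ltxy eqn Muvx Muvy no_z.
apply/negPn; rewrite negb_or; apply/andP=> -[nuxy nvxy].
have ltyn : y < n by rewrite -eqn.
have ltux := ltn_trans ltuv ltvx.
have facts t1 t2 t3 : t1 < t2 -> t2 < t3 -> M t1 t2 t3 ->
  [&& t3 <= y, ~~ cross [:: t1; t2; t3] [:: u; v; x],
     ~~ cross [:: t1; t2; t3] [:: u; v; y],
     ~~ [&& t1 == u, t2 == v, x < t3 & t3 < y],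
     ~~ [&& t1 == u, t2 == x & t3 == y] & ~~ [&& t1 == v, t2 == x & t3 == y]].
  move=> lt12 lt23 Mt; have := sys_lt3 Mt; rewrite -eqn ltnS => -> /=.
  rewrite !(sys_nc sysM Mt) //=; apply/and3P; split; apply/negP.
  - by case/and4P=> /eqP-? /eqP-? xt ty; have:= no_z _ xt ty; subst; rewrite Mt.
  - by case/and3P=> /eqP-? /eqP-? /eqP-?; subst; rewrite Mt in nuxy.
  - by case/and3P=> /eqP-? /eqP-? /eqP-?; subst; rewrite Mt in nvxy.
have [t1 [t2 [t3 [lt12 lt23 MT XT]]]] := sys_blocked ltvx ltxy ltyn nvxy.
have FT := facts _ _ _ lt12 lt23 MT.
have: [&& t1 == u, v < t2, t3 < y & (t3 <= x) || (x <= t2)].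
  order_decide.
case/and4P=> /eqP-Et1 vt2 t3y; rewrite {}Et1 {t1 lt12} in MT XT FT * => xT.
have [s1 [s2 [s3 [lt12 lt23' MS XS]]]] := sys_blocked ltux ltxy ltyn nuxy.
have FS := facts _ _ _ lt12 lt23' MS.
have ST := sys_nc sysM MS MT.
have: [&& s1 == v, x < s2, s3 < y, s3 <= t3 & x < t2].
  order_decide.
case/and5P=> /eqP-Es1 xs2 s3y s3t3 xt2; rewrite {}Es1 {s1 lt12 FS} in MS XS ST * .
have no_vty t : x < t -> t < y -> ~~ M v t y.
  move=> xt ty; apply/negP => Mvty; have X := sys_nc sysM Mvty MT.
  order_decide.
(* for q the largest end of such a triple, no vst of the family crosses uvq *)
pose P t := (t < y) && [exists s : 'I_t, (x <= s) && M v s t].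
have P_M s t : x <= s -> s < t -> t < y -> M v s t -> P t.
  move=> xs st ty Mt; rewrite /P ty; apply/existsP; exists (Ordinal st).
  by rewrite xs.
have [] := @ex_maxnP P y.
- by exists s3; apply: P_M MS; rewrite // ltnW.
- by move=> t /andP[/ltnW].
move=> q /andP[qy /existsP[[p ltpq] /= /andP[xp Mvpq]]] q_max.
have xq := leq_ltn_trans xp ltpq; have ltvq := ltn_trans ltvx xq.
have ltqn := ltn_trans qy ltyn.
have s3q : s3 <= q by apply: q_max; apply: P_M MS; rewrite // ltnW.
have no_vq s t : x <= s -> s < t -> M v s t -> t <= q.
  move=> xs st Mt; have := sys_lt3 Mt; rewrite -eqn ltnS leq_eqVlt.
  case/orP=> [/eqP ty|ty]; last by apply: q_max; apply: P_M Mt.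
  rewrite ty in Mt st; move: xs; rewrite leq_eqVlt => /orP[/eqP xs|xs].
    by rewrite xs Mt in nvxy.
  by have := no_vty _ xs st; rewrite Mt.
have qt3 : q <= t3.
  have X := sys_nc sysM Mvpq MT.
  (* the number of orderings is kept small by forgetting what is irrelevant *)
  clear - ltuv ltvx xp ltpq qy vt2 lt23 X s3t3 s3q xs2 lt23' xt2.
  order_decide.
have facts' t1 t2' t3' : t1 < t2' -> t2' < t3' -> M t1 t2' t3' ->
  [&& t3' <= y, ~~ cross [:: t1; t2'; t3'] [:: u; v; x],
     ~~ cross [:: t1; t2'; t3'] [:: u; v; y],
     ~~ cross [:: t1; t2'; t3'] [:: v; p; q],
     ~~ [&& t1 == v, x <= t2' & q < t3'] &
     ~~ [&& t1 == u, t2' == x & t3' == y]].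
  move=> lt1 lt2 Mt; have/and5P[-> _ _ _ /andP[-> _]] := facts _ _ _ lt1 lt2 Mt.
  rewrite !(sys_nc sysM Mt) // andbT /=; apply/negP.
  case/and3P=> [/eqP Et xt qt].
  by rewrite Et in Mt; have := no_vq _ _ xt lt2 Mt; rewrite leqNgt qt.
have nMq := no_z _ xq qy.
have [r1 [r2 [r3 [lt12 lt23'' MR XR]]]] := sys_blocked ltuv ltvq ltqn nMq.
have FR := facts' _ _ _ lt12 lt23'' MR.
have xp' : x < p.
  rewrite ltn_neqAle xp andbT; apply/negP => /eqP xp_eq.
  have SR := sys_nc sysM MS MR; have PS := sys_nc sysM MS Mvpq.
  rewrite -xp_eq in FR ltpq PS.
  clear - ltuv ltvx qy xq xs2 lt23' s3q FR XR SR PS lt12 lt23''.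
  order_decide.
have {FR}XR : [|| (r1 == u) && (r2 == p) && (q < r3), (r1 == p) && (q < r2) |
    [&& r1 < u, r2 == p & r3 == y]].
  clear - ltuv ltvx xp' ltpq qy lt12 lt23'' FR XR.
  order_decide.
have py := ltn_trans ltpq qy; have ltvp := ltn_trans ltvx xp'.
have ltpn := ltn_trans py ltyn.
have nMp := no_z _ xp' py.
have [o1 [o2 [o3 [lto12 lto23 MO XO]]]] := sys_blocked ltuv ltvp ltpn nMp.
have FO := facts' _ _ _ lto12 lto23 MO.
have OR := sys_nc sysM MO MR.
case/or3P: XR => [/andP[/andP[/eqP ? /eqP ?] qr3]|/andP[/eqP ? qr2]|].
- subst r1 r2; clear - ltuv ltvx xp' ltpq qy lto12 lto23 XO FO OR qr3.
  order_decide.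
- subst r1; clear - ltuv ltvx xp' ltpq qy lto12 lto23 XO FO OR lt23'' qr2.
  order_decide.
case/and3P=> r1u /eqP ? /eqP ?; subst r2 r3.
have OT := sys_nc sysM MO MT; have RT := sys_nc sysM MR MT.
clear - ltuv ltvx xp' ltpq qy vt2 lt23 qt3 t3y OT RT lto12 lto23 XO FO OR r1u.
order_decide.
Qed.
End MaxSystem.

(** * Rotations and reflections *)

Section Symmetry.
Variables (n : nat) (M : nat -> nat -> nat -> bool) (f g : nat -> nat).
Hypothesis sysM : max_system n M.
Hypotheses (f_lt : forall a, a < n -> f a < n).
Hypotheses (g_lt : forall a, a < n -> g a < n).
Hypotheses (fK : {in gtn n, cancel f g}) (gK : {in gtn n, cancel g f}).
Hypothesis f_sep : forall p q r s, p < n -> q < n -> r < n -> s < n ->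
  [&& p != r, p != s, q != r & q != s] ->
  separates (f p) (f q) (f r) (f s) = separates p q r s.

Lemma cross_map A B :
  all (gtn n) A -> all (gtn n) B -> cross (map f A) (map f B) = cross A B.
Proof.
move=> ltA ltB; rewrite /cross has_map; apply: eq_in_has => p pA /=.
have f_inj D a : all (gtn n) D -> a < n -> (f a \in map f D) = (a \in D).
  move=> ltD lta; apply/mapP/idP => [[b bD eq_ab]|aD]; last by exists a.
  by rewrite -(fK lta) eq_ab fK //; apply: (allP ltD).
rewrite has_map; apply: eq_in_has => q qA /=; rewrite has_map.
apply: eq_in_has => r rB /=; rewrite has_map; apply: eq_in_has => s sB /=.
have [ltp ltq] := (allP ltA _ pA, allP ltA _ qA).
have [ltr lts] := (allP ltB _ rB, allP ltB _ sB).
rewrite !f_inj //; apply: andb_id2l => pB; apply: andb_id2l => qB.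
apply: andb_id2l => rA; apply: andb_id2l => sA; apply: f_sep => //.
by apply/and4P; split; rewrite eq_sym ?(memPn pB) ?(memPn qB).
Qed.

Definition map_system a b c :=
  [&& a < n, b < n, c < n & M (f a) (f b) (f c)].

Lemma map_systemP : max_system n map_system.
Proof.
split; rewrite /map_system.
- by move=> a b c; rewrite (sysC12 sysM) andbCA.
- by move=> a b c; rewrite (sysC23 sysM) (andbCA (b < n)).
- by move=> a b c /and4P[].
- move=> a b c /and4P[lta ltb _ /(sys_neq sysM)]; apply: contra_neq.
  by move=> ->.
- move=> a b c x y z /and4P[lta ltb ltc Mabc] /and4P[ltx lty ltz Mxyz].
  rewrite -(@cross_map [:: a; b; c] [:: x; y; z]) /=.
  - exact: (sys_nc sysM Mabc Mxyz).
  - by rewrite lta ltb ltc.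
  - by rewrite ltx lty ltz.
- move=> a b c lta ltb ltc neq nc; rewrite lta ltb ltc /=.
  apply: (sys_max sysM); rewrite ?f_lt //.
    by rewrite !(can_in_eq fK).
  move=> x y z Mxyz; have ltx := sys_lt sysM Mxyz; have ltz := sys_lt3 sysM Mxyz.
  have lty : y < n by move: Mxyz; rewrite (sysC12 sysM); apply: sys_lt.
  have := nc (g x) (g y) (g z); rewrite !g_lt // !gK // Mxyz => /(_ isT).
  rewrite -cross_map /= ?g_lt ?lta ?ltb ?ltc //.
  by rewrite !gK.
Qed.

End Symmetry.

Definition rot (n d z : nat) : nat := if z + d < n then z + d else z + d - n.

Lemma rot_lt n d z : d <= n -> z < n -> rot n d z < n.
Proof. by rewrite /rot; case: ifP; lia. Qed.

Lemma rotK n d z : d <= n -> z < n -> rot n (n - d) (rot n d z) = z.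
Proof.
move=> led ltz; rewrite {2}/rot; case: (ltnP (z + d) n) => h;
  rewrite /rot; case: ltnP; lia.
Qed.

Lemma rot_sep n d p q r s : d <= n -> p < n -> q < n -> r < n -> s < n ->
  [&& p != r, p != s, q != r & q != s] ->
  separates (rot n d p) (rot n d q) (rot n d r) (rot n d s) = separates p q r s.
Proof.
move=> led ltp ltq ltr lts neq.
have E a b : a < n -> b < n -> a != b ->
    (rot n d a < rot n d b) = (a < b) (+) (a + d < n) (+) (b + d < n).
  move=> lta ltb neqab; rewrite /rot.
  by case: (ltnP (a + d) n); case: (ltnP (b + d) n); lia.
case/and4P: neq => pr ps qr qs; rewrite /separates !E //.
by case: (p + d < n) (q + d < n) (r + d < n) (s + d < n)
         (p < r) (q < r) (p < s) (q < s) => [] [] [] [] [] [] [] [].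
Qed.

Lemma rot_system n M d : d <= n -> max_system n M ->
  max_system n (map_system n M (rot n d)).
Proof.
move=> led sysM.
apply: (@map_systemP _ _ _ (rot n (n - d)) sysM) => [a|a|a|a|].
- exact: rot_lt.
- by apply: rot_lt; apply: leq_subr.
- exact: rotK.
- by move=> lta; have := rotK (leq_subr d n) lta; rewrite subKn.
- by move=> p q r s; apply: rot_sep.
Qed.

(** If uvx and uvy belong to a maximal family and no uvz does for z between x
    and y, then so does one of uxy and vxy.  The case where y is the last point
    suffices: rotate y there. *)
Lemma consecutive n M u v x y : max_system n M ->
    x < y -> ~~ (x <= u <= y) -> ~~ (x <= v <= y) -> M u v x -> M u v y ->
    (forall z, x < z -> z < y -> ~~ M u v z) ->
  M u x y || M v x y.
Proof.
move=> sysM xy ux vx Mx My no_z.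
have ltu := sys_lt sysM Mx; have neq_uv := sys_neq sysM Mx.
have ltv : v < n by move: Mx; rewrite (sysC12 sysM); apply: sys_lt.
have lty := sys_lt3 sysM My; have ltx := ltn_trans xy lty.
pose d := n - y.+1; have led : d <= n by apply: leq_subr.
pose M' := map_system n M (rot n (n - d)).
have sysM' : max_system n M' by apply: rot_system => //; apply: leq_subr.
have M'E a b c : a < n -> b < n -> c < n ->
    M' (rot n d a) (rot n d b) (rot n d c) = M a b c.
  by move=> lta ltb ltc; rewrite /M' /map_system !rot_lt // !rotK.
wlog ltuv : u v ux vx Mx My no_z ltu neq_uv ltv / rot n d u < rot n d v.
  move=> wl; have [/wl|/wl wl'|eq_uv] := ltngtP (rot n d u) (rot n d v).
  - exact.
  - rewrite orbC; apply: wl' => //; rewrite 1?(sysC12 sysM) 1?eq_sym //.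
    by move=> z xz zy; rewrite (sysC12 sysM) no_z.
  - by rewrite -(rotK led ltu) eq_uv rotK ?eqxx in neq_uv.
rewrite -!M'E //; apply: (consecutive_top sysM' ltuv); rewrite ?M'E //.
- by rewrite /rot /d; do 2!case: ifP; lia.
- by rewrite /rot /d; do 2!case: ifP; lia.
- by rewrite /rot /d; case: ifP; lia.
move=> z xz zy; have ltz : z < n by apply: ltn_trans zy _; apply: rot_lt.
rewrite -(rotK (leq_subr _ _ : n - d <= n) ltz) subKn // M'E ?rot_lt ?leq_subr //.
move: xz zy; rewrite /rot /d => xz zy; apply: no_z.
  by move: xz zy; do 3!case: ifP; lia.
by move: xz zy; do 3!case: ifP; lia.
Qed.

(** * Exchanges that remove the last point *)

(** The moves that replace the triple eam by ebc: the quadrilateral is b, a, c, m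
    and the triples eba, eac, ecm, ebm are its sides. *)
Definition exchangeable (m : nat) (M : nat -> nat -> nat -> bool) : Prop :=
  exists e b a c, [/\ b < a, a < c & c < m] /\
    [/\ M e b m, M e a m, M e c m, M e b a & M e a c].

Section Exchange.
Variables (m : nat) (M : nat -> nat -> nat -> bool).
Hypothesis sysM : max_system m.+1 M.

Let MC12 := sysC12 sysM.
Let MC23 := sysC23 sysM.
Let MC13 := sysC13 sysM.
Let Mrot := sys_rot sysM.

Ltac permute :=
  first [ done | by rewrite MC12 | by rewrite MC23 | by rewrite MC13
        | by rewrite Mrot | by rewrite -Mrot ].

Lemma sys_le_top a b c : M a b c -> c <= m.
Proof. by move=> /(sys_lt3 sysM). Qed.

Lemma adjacent k l a : l = k.+1 -> (a <= k) || ~~ (a < l).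
Proof. by move=> ->; rewrite ltnS orbN. Qed.

Lemma last_interval : 1 < m -> M m.-2 m.-1 m.
Proof.
move=> m_gt1; apply/negPn/negP => nM.
have lt1 : m.-2 < m.-1 by lia.
have lt2 : m.-1 < m by lia.
have [x [y [z [xy yz Mxyz X]]]] := sys_blocked sysM lt1 lt2 (ltnSn m) nM.
have zm := sys_le_top Mxyz.
have A a : (a <= m.-2) || ~~ (a < m.-1) by apply: adjacent; lia.
have B a : (a <= m.-1) || ~~ (a < m) by apply: adjacent; lia.
have [[Ax Ay Az] [Bx By Bz]] := (And3 (A x) (A y) (A z), And3 (B x) (B y) (B z)).
order_decide.
Qed.

Lemma first_interval : 1 < m -> M 0 1 m.
Proof.
move=> m_gt1; apply/negPn/negP => nM.
have lt1 : 0 < 1 by [].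
have [x [y [z [xy yz Mxyz X]]]] := sys_blocked sysM lt1 m_gt1 (ltnSn m) nM.
have zm := sys_le_top Mxyz.
have A a : (a <= 0) || ~~ (a < 1) by apply: adjacent.
have [Ax Ay Az] := And3 (A x) (A y) (A z).
have x0 := leq0n x.
order_decide.
Qed.

Lemma outer_interval : 1 < m -> M 0 m.-1 m.
Proof.
move=> m_gt1; apply/negPn/negP => nM.
have lt1 : 0 < m.-1 by lia.
have lt2 : m.-1 < m by lia.
have [x [y [z [xy yz Mxyz X]]]] := sys_blocked sysM lt1 lt2 (ltnSn m) nM.
have zm := sys_le_top Mxyz.
have B a : (a <= m.-1) || ~~ (a < m) by apply: adjacent; lia.
have [Bx By Bz] := And3 (B x) (B y) (B z).
have x0 := leq0n x.
order_decide.
Qed.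

(** Either r is not contained in any triple vrw with q < v < r < w, and then
    qr(r+1) crosses nothing; or w can be chosen largest among these triples, and
    then qrw crosses nothing. *)
Lemma next_triple p q r :
    p < q -> q < r -> r.+1 < m -> M p q r -> M p r m -> M q r m ->
    (forall z, q < z -> z < r -> ~~ M z r m) ->
  exists w, [/\ r < w, w < m & M q r w].
Proof.
move=> pq qr r1m Mpqr Mprm Mqrm no_z.
have rm : r < m by apply: ltnW.
have facts x y z : M x y z -> [&& z <= m, ~~ cross [:: x; y; z] [:: p; q; r],
    ~~ cross [:: x; y; z] [:: p; r; m] & ~~ cross [:: x; y; z] [:: q; r; m]].
  by move=> Mxyz; rewrite (sys_le_top Mxyz) !(sys_nc sysM Mxyz).
pose P w := (w < m) && [exists v : 'I_m, [&& q < v, v < r, r < w & M v r w]].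
have no_P v w : q < v -> v < r -> r < w -> M v r w -> P w.
  move=> qv vr rw Mvrw; have := sys_le_top Mvrw.
  rewrite leq_eqVlt => /orP[/eqP wm|wm].
    by have := no_z v qv vr; rewrite -wm Mvrw.
  rewrite /P wm; apply/existsP; exists (Ordinal (ltn_trans vr rm)).
  by rewrite /= qv vr rw Mvrw.
have [/existsP[w0 Pw0]|noP] := boolP [exists w : 'I_m, P w].
  have [] := @ex_maxnP P m; first by exists w0.
    by move=> w /andP[/ltnW].
  move=> w /andP[wm /existsP[v /and4P[qv vr rw Mvrw]]] w_max.
  exists w; split=> //; apply/negPn/negP => nM.
  have [x [y [z [xy yz Mxyz X]]]] := sys_blocked sysM qr rw (leqW wm) nM.
  have F := facts _ _ _ Mxyz; have Y := sys_nc sysM Mxyz Mvrw.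
  have Z : ~~ [&& y == r, q < x & w < z].
    apply/negP => /and3P[/eqP yr qx wz]; rewrite yr in Mxyz xy.
    have rz := ltn_trans rw wz.
    by have := w_max z (no_P _ _ qx xy rz Mxyz); rewrite leqNgt wz.
  clear w0 Pw0 w_max no_P.
  order_decide.
exists r.+1; split=> //; apply/negPn/negP => nM.
have [x [y [z [xy yz Mxyz X]]]] := sys_blocked sysM qr (ltnSn r) (leqW r1m) nM.
have F := facts _ _ _ Mxyz.
have Z : ~~ [&& y == r & q < x].
  apply/negP => /andP[/eqP yr qx]; rewrite yr in Mxyz xy yz.
  have Pz := no_P _ _ qx xy yz Mxyz; have /andP[zm _] := Pz.
  by move: noP; rewrite negb_exists => /forallP/(_ (Ordinal zm)); rewrite /= Pz.
have A a : (a <= r) || ~~ (a < r.+1) by apply: adjacent.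
have [Ax Ay Az] := And3 (A x) (A y) (A z).
have rr := ltnSn r.
order_decide.
Qed.

(** The edge qr of L, reached from the edge pr through the triple pqr, can be
    continued to a next edge zr through a triple qrz, either with z between q
    and r or, if there is no such edge, with z beyond r.  Then r and the
    neighbours p < q < z of r give the exchange.  The edge (m-2)(m-1) is the
    only one that cannot be continued. *)
Lemma exchange_right p q r :
    p < q -> q < r -> r < m -> M p q r -> M p r m -> M q r m ->
    (q != m.-2) || (r != m.-1) ->
  exchangeable m M.
Proof.
move=> pq qr rm Mpqr Mprm Mqrm not_last.
pose P z := [&& q < z, z < r & M z r m].
have [/existsP[z0 Pz0]|noP] := boolP [exists z : 'I_m, P z].
  have [] := @ex_minnP P; first by exists z0.
  move=> z /and3P[qz zr Mzrm] z_min.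
  have: M r q z || M m q z.
    apply: (consecutive sysM qz); try permute.
    - by rewrite negb_and -!ltnNge zr orbT.
    - by rewrite negb_and -!ltnNge (ltn_trans zr rm) orbT.
    move=> s qs sz; apply/negP => Mrms.
    have: P s by rewrite /P qs (ltn_trans sz zr); permute.
    by move/z_min; rewrite leqNgt sz.
  case/orP=> [Mrqz|Mmqz].
    exists r, p, q, z; split; first by split=> //; apply: ltn_trans rm.
    split; permute.
  have X := sys_nc sysM Mpqr Mmqz; clear z0 Pz0 z_min.
  by exfalso; order_decide.
have no_z z : q < z -> z < r -> ~~ M z r m.
  move=> qz zr; apply/negP => Mzrm; have zm := ltn_trans zr rm.
  move: noP; rewrite negb_exists => /forallP/(_ (Ordinal zm)).
  by rewrite /P /= qz zr Mzrm.
have r1m : r.+1 < m.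
  rewrite ltn_neqAle rm andbT; apply/negP => /eqP r1m.
  have E2 : m.-1 = r by rewrite -r1m.
  rewrite E2 eqxx orbF in not_last.
  have M2 : M m.-2 m.-1 m by apply: last_interval; lia.
  have qm2 : q < m.-2 by lia.
  have := no_z _ qm2; rewrite -[in _ < r]E2 -{1}E2 M2 => /(_ _)/negP[] //; lia.
have [w1 [rw1 w1m Mqrw1]] := next_triple pq qr r1m Mpqr Mprm Mqrm no_z.
pose Q w := [&& r < w, w < m & M q r w].
have [] := @ex_maxnP Q m; first by exists w1; rewrite /Q rw1 w1m.
  by move=> w /and3P[_ /ltnW].
move=> w /and3P[rw wm Mqrw] w_max.
have: M q w m || M r w m.
  apply: (consecutive sysM wm) => //.
  - by rewrite negb_and -!ltnNge (ltn_trans qr rw).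
  - by rewrite negb_and -!ltnNge rw.
  move=> z wz zm; apply/negP => Mqrz.
  have Qz : Q z by rewrite /Q (ltn_trans rw wz) zm.
  by have := w_max z Qz; rewrite leqNgt wz.
case/orP=> [Mqwm|Mrwm].
  have X := sys_nc sysM Mqwm Mprm; clear w1 rw1 w1m Mqrw1 w_max.
  by exfalso; order_decide.
exists r, p, q, w; split; first by split=> //; apply: ltn_trans rw.
by split; permute.
Qed.


(** A triple that crosses pqr but none of pqm, qrm, prm comes from an edge of L
    under pq that avoids p or under qr that avoids r. *)
Lemma triangle_in p q r :
    p < q -> q < r -> r < m -> M p q m -> M q r m -> M p r m ->
    (forall s t, p < s -> s < t -> t <= q -> ~~ M s t m) ->
    (forall s t, q <= s -> s < t -> t < r -> ~~ M s t m) ->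
  M p q r.
Proof.
move=> pq qr rm Mpq Mqr Mpr no_pq no_qr; apply/negPn/negP => nM.
have [x [y [z [xy yz Mxyz X]]]] := sys_blocked sysM pq qr (leqW rm) nM.
have zm := sys_le_top Mxyz.
have [X1 X2 X3] :=
  And3 (sys_nc sysM Mxyz Mpq) (sys_nc sysM Mxyz Mqr) (sys_nc sysM Mxyz Mpr).
have Z1 : ~~ [&& z == m, p < x & y <= q].
  apply/negP => /and3P[/eqP zE px yq].
  by have := no_pq _ _ px xy yq; rewrite -zE Mxyz.
have Z2 : ~~ [&& z == m, q <= x & y < r].
  apply/negP => /and3P[/eqP zE qx yr].
  by have := no_qr _ _ qx xy yr; rewrite -zE Mxyz.
order_decide.
Qed.

(** If L has an edge strictly below xy, it also has one from x or from y to a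
    point between them.  Otherwise take such an edge uv with u smallest and then
    v largest: no edge of L
    crosses xu or xv, so that xum and xvm are crossed by triples avoiding m,
    which are found to contain v and a point before u, respectively u and a
    point after v, and so cross each other.  At y an edge to y - 1 is tolerated,
    as y - 1 may be m - 2. *)
Lemma inner_chord_left x y u v :
    x < u -> u < v -> v < y -> y < m -> M x y m -> M u v m ->
    (forall z, x < z -> z < y -> ~~ M x z m) ->
    (forall z, x < z -> z.+1 < y -> ~~ M z y m) ->
  False.
Proof.
move=> xu0 uv0 vy0 ym Mxy Muv0 no_x no_y.
pose P u := [&& x < u, u < y & [exists v : 'I_y, (u < v) && M u v m]].
have PI a b : x < a -> a < b -> b < y -> M a b m -> P a.
  move=> xa ab yb Mab; rewrite /P xa (ltn_trans ab yb); apply/existsP.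
  by exists (Ordinal yb); rewrite ab.
have [] := @ex_minnP P; first by exists u; apply: PI Muv0.
move=> {u v xu0 uv0 vy0 Muv0} u /and3P[xu uy /existsP[v0 uv0]] u_min.
have [] := @ex_maxnP (fun v => [&& u < v, v < y & M u v m]) y.
- by case/andP: uv0 => ? ?; exists v0; apply/and3P; split=> //; apply: ltn_ord.
- by move=> v /and3P[_ /ltnW].
move=> v /and3P[uv vy Muv] v_max {v0 uv0}.
have facts a b c : a < b -> b < c -> M a b c -> [&& c <= m,
    ~~ cross [:: a; b; c] [:: x; y; m], ~~ cross [:: a; b; c] [:: u; v; m],
    ~~ [&& c == m, x < a, a < u & b < y], ~~ [&& c == m, a < v, x < a & b == y],
    ~~ [&& c == m, a == u, v < b & b < y] & ~~ [&& c == m, a == x & b < y]].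
  move=> ab bc Mabc; rewrite (sys_le_top Mabc) !(sys_nc sysM Mabc) //=.
  apply/and4P; split; apply/negP.
  - case/and4P=> /eqP cm xa au yb; rewrite cm in Mabc.
    by have := u_min a (PI _ _ xa ab yb Mabc); rewrite leqNgt au.
  - case/and4P=> /eqP cm av xa /eqP yb; rewrite cm yb in Mabc.
    by have := no_y a xa (leq_ltn_trans av vy); rewrite Mabc.
  - case/and4P=> /eqP cm /eqP au vb yb; rewrite cm au in Mabc ab.
    by have := v_max b; rewrite ab yb Mabc leqNgt vb => /(_ isT).
  - case/and3P=> /eqP cm /eqP ax yb; rewrite cm ax in Mabc ab.
    by have := no_x b ab yb; rewrite Mabc.
have nxu := no_x u xu uy; have xv := ltn_trans xu uv.
have nxv := no_x v xv vy; have vm := ltn_trans vy ym.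
have um := ltn_trans uv vm.
have [a [b [c [ab bc Mabc X]]]] := sys_blocked sysM xu um (ltnSn m) nxu.
have [a' [b' [c' [ab' bc' Mabc' X']]]] := sys_blocked sysM xv vm (ltnSn m) nxv.
have F := facts _ _ _ ab bc Mabc; have F' := facts _ _ _ ab' bc' Mabc'.
have Y := sys_nc sysM Mabc Mabc'.
have {F}X : [&& x <= b, b < u & c == v].
  clear - xu uv vy ym ab bc X F.
  order_decide.
clear - xu uv vy ym ab bc X F' X' ab' bc' Y.
order_decide.
Qed.

End Exchange.

(** The reflection of the circle that fixes the last point. *)
Definition refl (m z : nat) : nat := if z == m then m else m.-1 - z.

Lemma refl_lt m z : z < m.+1 -> refl m z < m.+1.
Proof. by rewrite /refl; case: eqP; lia. Qed.

Lemma reflK m z : z < m.+1 -> refl m (refl m z) = z.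
Proof.
move=> zm; rewrite {2}/refl; case: eqP => [->|ne]; first by rewrite /refl eqxx.
by rewrite /refl; case: eqP; lia.
Qed.

Lemma refl_sep m p q r s : p < m.+1 -> q < m.+1 -> r < m.+1 -> s < m.+1 ->
  [&& p != r, p != s, q != r & q != s] ->
  separates (refl m p) (refl m q) (refl m r) (refl m s) = separates p q r s.
Proof.
move=> ltp ltq ltr lts neq.
have E a b : a < m.+1 -> b < m.+1 -> a != b ->
    (refl m a < refl m b) = (a < b) (+) ((a != m) && (b != m)).
  move=> lta ltb ab; rewrite /refl.
  by case: (eqVneq a m); case: (eqVneq b m); lia.
case/and4P: neq => pr ps qr qs; rewrite /separates !E //.
have: ~~ (((p == m) || (q == m)) && ((r == m) || (s == m))) by lia.
by case: (p == m) (q == m) (r == m) (s == m)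
         (p < r) (q < r) (p < s) (q < s) => [] [] [] [] [] [] [] [].
Qed.

Lemma refl_system m M : max_system m.+1 M ->
  max_system m.+1 (map_system m.+1 M (refl m)).
Proof.
move=> sysM; apply: (@map_systemP _ _ _ (refl m) sysM).
1,2: by move=> a; apply: refl_lt.
1,2: by move=> a; apply: reflK.
by move=> p q r s; apply: refl_sep.
Qed.

Section Reflection.
Variables (m : nat) (M : nat -> nat -> nat -> bool).
Hypothesis sysM : max_system m.+1 M.
Let M' := map_system m.+1 M (refl m).
Let sysM' : max_system m.+1 M' := refl_system sysM.

Lemma reflE a b c : a <= m -> b <= m -> c <= m ->
  M' (refl m a) (refl m b) (refl m c) = M a b c.
Proof.
by move=> lta ltb ltc; rewrite /M' /map_system !refl_lt // !reflK.
Qed.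

Lemma refl_top : refl m m = m. Proof. by rewrite /refl eqxx. Qed.

Lemma refl_below a : a < m -> refl m a = m.-1 - a.
Proof. by rewrite /refl; case: eqP => // ->; rewrite ltnn. Qed.

Lemma refl_exchangeable : exchangeable m M' -> exchangeable m M.
Proof.
case=> e [b [a [c [[ba ac cm] [Meb Mea Mec Meba Meac]]]]].
have E x y z : M' x y z -> M (refl m x) (refl m y) (refl m z) by case/and4P.
have Etop x y : M' x y m -> M (refl m x) (refl m y) m.
  by move/E; rewrite refl_top.
have am := ltn_trans ac cm; have bm := ltn_trans ba am.
exists (refl m e), (refl m c), (refl m a), (refl m b).
split; first by rewrite !refl_below //; split; lia.
split; auto; rewrite (sysC23 sysM); auto.
Qed.

Lemma exchange_left p q r :
    p < q -> q < r -> r < m -> M p q r -> M p q m -> M p r m ->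
    (p != 0) || (q != 1) ->
  exchangeable m M.
Proof.
move=> pq qr rm Mpqr Mpqm Mprm not_first; apply: refl_exchangeable.
have [qm pm] : q < m /\ p < m by lia.
apply: (@exchange_right _ _ sysM' (refl m r) (refl m q) (refl m p)).
1-3,7: by rewrite !refl_below //; lia.
- by rewrite (sysC13 sysM') reflE // ltnW.
- by rewrite -{3}refl_top (sysC12 sysM') reflE // ltnW.
- by rewrite -{3}refl_top (sysC12 sysM') reflE // ltnW.
Qed.

Lemma inner_chord_right x y u v :
    x < u -> u < v -> v < y -> y < m -> M x y m -> M u v m ->
    (forall z, x < z -> z < y -> ~~ M z y m) ->
    (forall z, x.+1 < z -> z < y -> ~~ M x z m) ->
  False.
Proof.
move=> xu uv vy ym Mxy Muv no_y no_x.
have [vm um xm] : [/\ v < m, u < m & x < m] by split; lia.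
apply: (@inner_chord_left _ _ sysM' (refl m y) (refl m x) (refl m v) (refl m u)).
1-4: by rewrite !refl_below //; lia.
1,2: by rewrite -[m in M' _ _ m]refl_top (sysC12 sysM') reflE // ltnW.
all: move=> z; rewrite !refl_below // => xz zy; apply/negP => Mz.
all: have zK : m.-1 - (m.-1 - z) = z by lia.
all: have z'm : m.-1 - z < m by lia.
- have /negP[] := no_y (m.-1 - z) ltac:(lia) ltac:(lia).
  rewrite -reflE ?(ltnW z'm) ?(ltnW ym) // refl_top (refl_below ym).
  by rewrite (refl_below z'm) zK (sysC12 sysM').
- have /negP[] := no_x (m.-1 - z) ltac:(lia) ltac:(lia).
  rewrite -reflE ?(ltnW z'm) ?(ltnW xm) // refl_top (refl_below xm).
  by rewrite (refl_below z'm) zK (sysC12 sysM').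
Qed.

End Reflection.

Section ChordExchange.
Variables (m : nat) (M : nat -> nat -> nat -> bool).
Hypotheses (sysM : max_system m.+1 M) (m_gt3 : 3 < m).

Let MC12 := sysC12 sysM.
Let MC23 := sysC23 sysM.
Let MC13 := sysC13 sysM.
Let Mrot := sys_rot sysM.

Ltac permute :=
  first [ done | by rewrite MC12 | by rewrite MC23 | by rewrite MC13
        | by rewrite Mrot | by rewrite -Mrot ].

(** Induction on the span of the edge xy, below which lies an edge uv of L other
    than xy, 01 and (m-2)(m-1).  If x has a suitable neighbour below xy, let z
    be the largest one: then xzy belongs to the family, whence an exchange, or
    zy is an edge and xzy a triangle.  The same holds for y.  If neither x nor y
    has one, then by the preceding lemmas x = 0 and y = m - 1, and 0 has only the
    neighbours 1 and m - 1, so that 01(m-1) is in the family and crosses uvm. *)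
Lemma chord_exchange d x y u v :
    y - x <= d -> x < y -> y < m -> M x y m ->
    x <= u -> u < v -> v <= y -> (u != x) || (v != y) ->
    (u != 0) || (v != 1) -> (u != m.-2) || (v != m.-1) -> M u v m ->
  exchangeable m M.
Proof.
elim: d x y u v => [|d IHd] x y u v; first lia.
move=> led xy ym Mxy xu uv vy neq_xy not_first not_last Muv.
(* an edge under a side of the triangle xzy gives an exchange by induction; *)
(* without such an edge the triangle belongs to the family *)
have triangle z : x < z -> z < y -> M x z m -> M z y m -> exchangeable m M.
  move=> xz zy Mxz Mzy; have zm := ltn_trans zy ym.
  have [/existsP[s /existsP[t /and4P[xs st tz Mst]]]|no_xz] := boolP
      [exists s : 'I_m, exists t : 'I_m, [&& x < s, s < t, t <= z & M s t m]].
    by apply: (IHd x z s t); rewrite // ?(ltnW xs) //; clear IHd; lia.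
  have [/existsP[s /existsP[t /and4P[zs st ty Mst]]]|no_zy] := boolP
      [exists s : 'I_m, exists t : 'I_m, [&& z <= s, s < t, t < y & M s t m]].
    by apply: (IHd z y s t); rewrite // ?(ltnW ty) //; clear IHd; lia.
  have Mxzy : M x z y.
    apply: (triangle_in sysM) => // s t.
      move=> xs st tz; apply/negP => Mst; have tm := leq_ltn_trans tz zm.
      move: no_xz; rewrite negb_exists.
      move/forallP/(_ (Ordinal (ltn_trans st tm))).
      by rewrite negb_exists => /forallP/(_ (Ordinal tm)); rewrite /= xs st tz Mst.
    move=> zs st ty; apply/negP => Mst; have tm := ltn_trans ty ym.
    move: no_zy; rewrite negb_exists => /forallP/(_ (Ordinal (ltn_trans st tm))).
    by rewrite negb_exists => /forallP/(_ (Ordinal tm)); rewrite /= zs st ty Mst.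
  have [z_last|z_not_last] := boolP ((z != m.-2) || (y != m.-1)).
    exact: (exchange_right sysM xz zy).
  by apply: (exchange_left sysM xz zy) => //; clear IHd; lia.
have left w : x < w -> w < y -> M x w m -> (x != 0) || (w != 1) ->
    exchangeable m M.
  move=> xw wy Mxw nfirst; pose P z := [&& x < z, z < y & M x z m].
  have [] := @ex_maxnP P y; first by exists w; rewrite /P xw wy.
    by move=> z /and3P[_ /ltnW].
  move=> z /and3P[xz zy Mxz] z_max.
  have wz : w <= z by apply: z_max; rewrite /P xw wy.
  have: M x z y || M m z y.
    apply: (consecutive sysM zy); try permute.
    - by rewrite negb_and -!ltnNge xz.
    - by rewrite negb_and -!ltnNge ym orbT.
    move=> s zs sy; apply/negP => Ms; have := z_max s.
    by rewrite /P (ltn_trans xz zs) sy leqNgt zs MC23 Ms => /(_ isT).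
  case/orP=> [Mxzy|Mmzy]; last by apply: (triangle z) => //; permute.
  by apply: (exchange_left sysM xz zy) => //; clear IHd triangle z_max; lia.
have right w : x < w -> w < y -> M w y m -> (w != m.-2) || (y != m.-1) ->
    exchangeable m M.
  move=> xw wy Mwy nlast; pose P z := [&& x < z, z < y & M z y m].
  have [] := @ex_minnP P; first by exists w; rewrite /P xw wy.
  move=> z /and3P[xz zy Mzy] z_min.
  have zw : z <= w by apply: z_min; rewrite /P xw wy.
  have: M y x z || M m x z.
    apply: (consecutive sysM xz); try permute.
    - by rewrite negb_and -!ltnNge zy orbT.
    - by rewrite negb_and -!ltnNge (ltn_trans zy ym) orbT.
    move=> s xs sz; apply/negP => Ms; have := z_min s.
    have -> : P s by rewrite /P xs (ltn_trans sz zy); permute.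
    by rewrite leqNgt sz => /(_ isT).
  case/orP=> [Myxz|Mmxz]; last by apply: (triangle z) => //; permute.
  apply: (exchange_right sysM xz zy) => //; try permute.
  by clear IHd triangle left z_min; lia.
have [eq_ux|neq_ux] := eqVneq u x.
  rewrite eq_ux eqxx /= in neq_xy uv not_first Muv *.
  by apply: (left v); rewrite // ltn_neqAle neq_xy.
have {neq_ux xu} xu : x < u by rewrite ltn_neqAle eq_sym neq_ux.
have [eq_vy|neq_vy] := eqVneq v y.
  by rewrite eq_vy in uv not_last Muv *; apply: (right u).
have {neq_vy vy neq_xy} vy : v < y by rewrite ltn_neqAle neq_vy.
have [/existsP[z /and4P[xz zy Mxz nfirst]]|no_x] := boolP
    [exists z : 'I_m, [&& x < z, z < y, M x z m & (x != 0) || (z != 1 :> nat)]].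
  exact: (left z).
have [/existsP[z /and4P[xz zy Mzy nlast]]|no_y] := boolP
    [exists z : 'I_m,
      [&& x < z, z < y, M z y m & (z != m.-2 :> nat) || (y != m.-1)]].
  exact: (right z).
have {}no_x z : x < z -> z < y -> (x != 0) || (z != 1) -> ~~ M x z m.
  move=> xz zy nfirst; apply/negP => Mxz; have zm := ltn_trans zy ym.
  move: no_x; rewrite negb_exists => /forallP/(_ (Ordinal zm)).
  by rewrite /= xz zy Mxz nfirst.
have {}no_y z : x < z -> z < y -> (z != m.-2) || (y != m.-1) -> ~~ M z y m.
  move=> xz zy nlast; apply/negP => Mzy; have zm := ltn_trans zy ym.
  move: no_y; rewrite negb_exists => /forallP/(_ (Ordinal zm)).
  by rewrite /= xz zy Mzy nlast.
exfalso; clear IHd triangle left right.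
have [x0|x_neq0] := eqVneq x 0; last first.
  apply: (inner_chord_left sysM xu uv vy) => // z xz zy.
    by apply: no_x; rewrite // x_neq0.
  by apply: no_y; rewrite // ?(ltnW zy) //; lia.
have [y_top|y_neq] := eqVneq y m.-1; last first.
  apply: (inner_chord_right sysM xu uv vy) => // z xz zy.
    by apply: no_y; rewrite // y_neq orbT.
  by apply: no_x; rewrite // ?(ltnW xz) //; lia.
have y1 : 1 < y by lia.
have M01 := first_interval sysM ltac:(lia).
rewrite {}x0 in xy Mxy xu no_x no_y led.
have: M 0 1 y || M m 1 y.
  apply: (consecutive sysM y1); try permute.
    by rewrite negb_and -!ltnNge ym orbT.
  move=> z z1 zy; apply/negP => Mz.
  have /negP[] := no_x z (ltnW z1) zy ltac:(lia).
  by permute.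
case/orP=> [M01y|Mm1y].
  have X := sys_nc sysM Muv M01y.
  have A := adjacent u (erefl 1).
  clear - xu uv vy ym X A.
  order_decide.
have /negP[] := no_y 1 isT y1 ltac:(lia).
by permute.
Qed.

Theorem nontrivial_exchange a b :
    M a b m -> a < b -> b < m -> (a != 0) || (b != 1) ->
    (a != 0) || (b != m.-1) -> (a != m.-2) || (b != m.-1) ->
  exchangeable m M.
Proof.
move=> Mab ab bm nfirst nouter nlast.
have lt0 : 0 < m.-1 by lia.
have ltm : m.-1 < m by lia.
have M0 := outer_interval sysM ltac:(lia).
apply: (chord_exchange (leqnn _) lt0 ltm M0 (leq0n a) ab) => //; lia.
Qed.

End ChordExchange.

(** * Weak separation as absence of crossings *)

Section WeakSeparation.
Variable n : nat.
Implicit Types I J : {set 'I_n}.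

Definition vals I : seq nat := [seq val i | i <- enum I].

Lemma mem_vals (i : 'I_n) I : (val i \in vals I) = (i \in I).
Proof. by rewrite mem_map ?mem_enum //; apply: val_inj. Qed.

(** J \ I splits around I \ J unless it has a point between two points of
    I \ J. *)
Lemma surroundsE I J : surrounds I J =
  ~~ [exists p in I :\: J, exists q in I :\: J, exists r in J :\: I, p < r < q].
Proof.
apply/idP/idP.
  case/existsP=> J1 /existsP[J2 /and4P[/eqP eqJ _ J1_lt J2_gt]].
  apply/negP => /exists_inP[p pI /exists_inP[q qI /exists_inP[r]]].
  rewrite -eqJ inE => /orP[rJ|rJ] /andP[pr rq].
    by have := forall_inP (forall_inP J1_lt r rJ) p pI; lia.
  by have := forall_inP (forall_inP J2_gt q qI) r rJ; lia.
move=> no_between.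
pose J1 := [set r in J :\: I | [forall p in I :\: J, r < p]].
apply/existsP; exists J1; apply/existsP; exists ((J :\: I) :\: J1).
apply/and4P; split.
- apply/eqP/setP => r; rewrite in_setU in_setD [r \in J1]in_set.
  by case: (r \in _); case: [forall _ in _, _].
- rewrite -setI_eq0; apply/eqP/setP => r; rewrite in_setI in_setD.
  by case: (r \in J1); rewrite /= ?andbF ?in_set0.
- apply/forall_inP => r; rewrite inE => /andP[_ rP].
  by apply/forall_inP => p pI; apply: (forall_inP rP).
apply/forall_inP => q qI; apply/forall_inP => r; rewrite in_setD => /andP[rJ1 rJ].
move: rJ1; rewrite in_set rJ /= negb_forall_in => /exists_inP[p pI rp].
have neq (x y : 'I_n) : x \in I :\: J -> y \in J :\: I -> x != y :> nat.
  rewrite !inE => /andP[xJ xI] /andP[yI _]; apply: contraNneq yI => /val_inj <-.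
  exact: xI.
have := neq _ _ pI rJ; have := neq _ _ qI rJ.
case: (ltnP q r) => // rq qr pr; case/negP: no_between.
apply/exists_inP; exists p => //; apply/exists_inP; exists q => //.
by apply/exists_inP; exists r => //; lia.
Qed.

(** If both sets have a point between two points of the other, then two of these
    points in each set alternate. *)
Lemma weakly_separatedE I J :
  weakly_separated I J = ~~ cross (vals I) (vals J).
Proof.
rewrite /weakly_separated !surroundsE -negb_and; congr (~~ _); apply/idP/idP.
  case/andP=> /exists_inP[p pI /exists_inP[q qI /exists_inP[r rJ /andP[pr rq]]]].
  case/exists_inP=> r1 r1J /exists_inP[r2 r2J /exists_inP[p1 p1I /andP[rp1 pr1]]].
  have X (a b c d : 'I_n) : a \in I :\: J -> b \in I :\: J -> c \in J :\: I ->
      d \in J :\: I -> separates a b c d -> cross (vals I) (vals J).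
    rewrite !inE => /andP[aJ aI] /andP[bJ bI] /andP[cI cJ] /andP[dI dJ] sep.
    apply/hasP; exists (val a); rewrite ?mem_vals //.
    apply/hasP; exists (val b); rewrite ?mem_vals //.
    apply/hasP; exists (val c); rewrite ?mem_vals //.
    by apply/hasP; exists (val d); rewrite ?mem_vals // aJ bJ cI dI.
  have [qr2|r2q] := ltnP q r2.
    by apply: (X p q r r2); rewrite // /separates; lia.
  have [r1p|pr1'] := ltnP r1 p.
    by apply: (X p q r r1); rewrite // /separates; lia.
  have neq (x y : 'I_n) : x \in I :\: J -> y \in J :\: I -> x != y :> nat.
    rewrite !inE => /andP[xJ xI] /andP[yI _]; apply: contraNneq yI => /val_inj <-.
    exact: xI.
  have := neq _ _ pI r1J; have := neq _ _ qI r2J => ? ?.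
  by apply: (X p p1 r1 r2); rewrite // /separates; lia.
case/hasP=> _ /mapP[p pI ->] /hasP[_ /mapP[q qI ->] /hasP[_ /mapP[r rJ ->]]].
case/hasP=> _ /mapP[s sJ ->] /and5P[]; rewrite !mem_vals => pJ qJ rI sI sep.
rewrite !mem_enum in pI qI rJ sJ.
have {pI pJ} pI : p \in I :\: J by rewrite inE pJ.
have {qI qJ} qI : q \in I :\: J by rewrite inE qJ.
have {rI rJ} rJ : r \in J :\: I by rewrite inE rI.
have {sI sJ} sJ : s \in J :\: I by rewrite inE sI.
have B (X Y : {set 'I_n}) a b c : a \in X -> b \in X -> c \in Y -> a < c < b ->
    [exists a in X, exists b in X, exists c in Y, a < c < b].
  move=> aX bX cY acb; apply/exists_inP; exists a => //.
  by apply/exists_inP; exists b => //; apply/exists_inP; exists c.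
have neq (x y : 'I_n) : x \in I :\: J -> y \in J :\: I -> x != y :> nat.
  rewrite !inE => /andP[xJ xI] /andP[yI _]; apply: contraNneq yI => /val_inj <-.
  exact: xI.
move: (neq _ _ pI rJ) (neq _ _ pI sJ) (neq _ _ qI rJ) (neq _ _ qI sJ).
move: sep; rewrite /separates /= => sep pr ps qr qs; apply/andP; split.
  have [|npq] := boolP ((p < r < q) || (p < s < q)).
    by case/orP; apply: B.
  have: (q < r < p) || (q < s < p) by lia.
  by case/orP; apply: B.
have [|nrs] := boolP ((r < p < s) || (r < q < s)).
  by case/orP; apply: B.
have: (s < p < r) || (s < q < r) by lia.
by case/orP; apply: B.
Qed.

Lemma weakly_separatedC I J : weakly_separated I J = weakly_separated J I.
Proof. by rewrite !weakly_separatedE crossC. Qed.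

Lemma weakly_separatedxx I : weakly_separated I I.
Proof.
rewrite weakly_separatedE; apply/hasPn => p pI; apply/hasPn => q _.
by apply/hasPn => r _; apply/hasPn => s _; rewrite pI.
Qed.

Lemma weakly_separated_triples I J (A B : seq nat) :
    vals I =i A -> vals J =i B -> weakly_separated I J = ~~ cross A B.
Proof. by move=> eqA eqB; rewrite weakly_separatedE (cross_eq_mem eqA eqB). Qed.
End WeakSeparation.

(** * Maximal collections of 3-subsets as systems of triples *)

Section Collections.
Variable n : nat.
Implicit Types (S T X Y : {set 'I_n}) (C D : {set {set 'I_n}}).

Lemma max_wsP C : max_ws_collection 3 C <->
  [/\ {in C, forall S, #|S| = 3}, {in C &, forall S T, weakly_separated S T} &
    forall T, #|T| = 3 -> {in C, forall S, weakly_separated S T} -> T \in C].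
Proof.
have wsP D : reflect ({in D, forall S, #|S| = 3} /\
    {in D &, forall S T, weakly_separated S T}) (ws_collection 3 D).
  apply: (iffP andP) => [[card3 ws]|[card3 ws]]; split.
  - by move=> S SD; apply/eqP/(forall_inP card3).
  - by move=> S T SD TD; apply: (forall_inP (forall_inP ws S SD)).
  - by apply/forall_inP => S SD; rewrite card3.
  - by apply/forall_inP => S SD; apply/forall_inP => T TD; apply: ws.
split=> [/maxsetP[/wsP[card3 ws] maxC]|[card3 ws maxC]].
  split=> // T T3 wsT; rewrite -(maxC (T |: C)) ?setU11 ?subsetUr //.
  apply/wsP; split=> [S /setU1P[->|/card3]|S S'] //.
  case/setU1P=> [->|SC] /setU1P[->|S'C].
  - exact: weakly_separatedxx.
  - by rewrite weakly_separatedC; apply: wsT.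
  - exact: wsT.
  - exact: ws.
apply/maxsetP; split; first by apply/wsP.
move=> B /wsP[B3 wsB] sCB; apply/eqP; rewrite eqEsubset sCB andbT.
apply/subsetP => T TB; apply: maxC; first exact: B3.
by move=> S SC; apply: wsB => //; apply: (subsetP sCB).
Qed.

Lemma vals3 (a b c : 'I_n) : vals [set a; b; c] =i [:: val a; val b; val c].
Proof.
move=> t; apply/mapP/idP => [[x]|].
  by rewrite mem_enum !inE -orbA => /or3P[]/eqP-> ->; rewrite eqxx ?orbT.
by rewrite !inE => /or3P[]/eqP->; [exists a|exists b|exists c];
   rewrite // mem_enum !inE eqxx ?orbT.
Qed.

Lemma card3_set3 S : #|S| = 3 ->
  exists a b c : 'I_n, [/\ [&& a != b, a != c & b != c] & S = [set a; b; c]].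
Proof.
move=> S3; have : 2 < #|S| by rewrite S3.
case/card_gt2P=> a [b [c [[aS bS cS] [ab bc ca]]]].
exists a, b, c; split; first by rewrite ab bc eq_sym ca.
apply/esym/eqP; rewrite eqEcard S3; apply/andP; split.
  by apply/subsetP => x; rewrite !inE -orbA => /or3P[]/eqP->.
by rewrite (setUC [set a; b]) cardsU1 cards2 !inE negb_or ca eq_sym bc ab.
Qed.

Lemma card_set3 (a b c : 'I_n) :
  [&& a != b, a != c & b != c] -> #|[set a; b; c]| = 3.
Proof.
case/and3P=> ab ac bc.
by rewrite (setUC [set a; b]) cardsU1 cards2 !inE negb_or !(eq_sym c) ab ac bc.
Qed.

Definition triples C (a b c : nat) : bool :=
  [exists x : 'I_n, exists y : 'I_n, exists z : 'I_n,
    [&& x == a :> nat, y == b :> nat, z == c :> nat,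
      [&& a != b, a != c & b != c] & [set x; y; z] \in C]].

Lemma triplesP C (x y z : 'I_n) :
  triples C x y z = [&& x != y, x != z & y != z] && ([set x; y; z] \in C).
Proof.
apply/existsP/andP => [[x' /existsP[y' /existsP[z' /and5P[]]]]|[neq xyzC]].
  by move=> /eqP/val_inj-> /eqP/val_inj-> /eqP/val_inj-> neq xyzC.
exists x; apply/existsP; exists y; apply/existsP; exists z.
by rewrite !eqxx xyzC andbT.
Qed.

Lemma triples_lt C a b c : triples C a b c -> [/\ a < n, b < n & c < n].
Proof.
by case/existsP=> x /existsP[y /existsP[z /and4P[/eqP<- /eqP<- /eqP<- _]]].
Qed.

Lemma triples_ord C a b c : triples C a b c ->
  exists x y z : 'I_n, [/\ a = x, b = y, c = z & triples C x y z].
Proof.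
move=> Cabc; have [lta ltb ltc] := triples_lt Cabc.
by exists (Ordinal lta), (Ordinal ltb), (Ordinal ltc).
Qed.

Lemma triplesC12 C a b c : triples C a b c -> triples C b a c.
Proof.
case/triples_ord=> x [y [z [-> -> ->]]].
rewrite !triplesP (eq_sym y x) (setUC [set y]).
by case/andP=> /and3P[-> -> ->].
Qed.

Lemma triplesC23 C a b c : triples C a b c -> triples C a c b.
Proof.
case/triples_ord=> x [y [z [-> -> ->]]]; rewrite !triplesP (eq_sym z y) setUAC.
by case/andP=> /and3P[-> -> ->].
Qed.

Lemma ws_triple (a b c x y z : 'I_n) :
  weakly_separated [set a; b; c] [set x; y; z] =
    ~~ cross [:: val a; val b; val c] [:: val x; val y; val z].
Proof. by apply: weakly_separated_triples; apply: vals3. Qed.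

Lemma triples_system C : max_ws_collection 3 C -> max_system n (triples C).
Proof.
case/max_wsP=> card3 ws maxC; split.
- by move=> a b c; apply/idP/idP; apply: triplesC12.
- by move=> a b c; apply/idP/idP; apply: triplesC23.
- by move=> a b c /triples_lt[].
- move=> a b c /triples_ord[x [y [z [-> -> _]]]].
  by rewrite triplesP => /andP[/and3P[]].
- move=> a b c a' b' c' /triples_ord[x [y [z [-> -> ->]]]] +.
  move=> /[swap] /triples_ord[x' [y' [z' [-> -> ->]]]] + Cxyz; move: Cxyz.
  by rewrite !triplesP => /andP[_ SC] /andP[_ TC]; rewrite -ws_triple ws.
move=> a b c lta ltb ltc neq nc.
rewrite -[a]/(val (Ordinal lta)) -[b]/(val (Ordinal ltb)).
rewrite -[c]/(val (Ordinal ltc)).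
rewrite triplesP neq /=; apply: maxC; first by rewrite card_set3.
move=> S SC; have [x [y [z [neqS SE]]]] := card3_set3 (card3 S SC).
by rewrite SE ws_triple; apply: nc; rewrite triplesP neqS -SE.
Qed.

(** * Moves: maximality and reversibility *)

(** For X and Y the diagonals of a quadrilateral, a set weakly separated from
    all four sides either is a diagonal or is weakly separated from both.  So
    the exchange of X and Y does not affect which other sets can be present. *)
Lemma replace_max C X Y (sides : seq {set 'I_n}) :
    max_ws_collection 3 C -> X \in C -> #|Y| = 3 -> ~~ weakly_separated X Y ->
    {subset sides <= C} -> X \notin sides ->
    (forall T, #|T| = 3 -> {in sides, forall S, weakly_separated S T} ->
      T != X -> T != Y -> weakly_separated X T && weakly_separated Y T) ->
  max_ws_collection 3 (Y |: (C :\ X)).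
Proof.
move=> /max_wsP[card3 ws maxC] XC Y3 nXY sidesC Xsides diag.
have YC : Y \notin C by apply: contra nXY => YC; apply: ws.
have wsY S : S \in C -> S != X -> weakly_separated Y S.
  move=> SC SX; have SY : S != Y by apply: contraNneq YC => <-.
  have sidesS : {in sides, forall A, weakly_separated A S}.
    by move=> A /sidesC AC; apply: ws.
  by have /andP[] := diag S (card3 S SC) sidesS SX SY.
apply/max_wsP; split.
- by move=> S; rewrite !inE => /orP[/eqP->|/andP[_ /card3]].
- move=> S T; rewrite !inE => /orP[/eqP->|/andP[SX SC]] /orP[/eqP->|/andP[TX TC]].
  + exact: weakly_separatedxx.
  + exact: wsY.
  + by rewrite weakly_separatedC; apply: wsY.
  + exact: ws.
move=> T T3 wsT; rewrite !inE; have [//|TY /=] := eqVneq T Y.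
have TX : T != X.
  apply: contraNneq nXY => <-; rewrite weakly_separatedC.
  by apply: wsT; rewrite setU11.
rewrite TX; apply: maxC => // S SC; have [->|SX] := eqVneq S X; last first.
  by apply: wsT; rewrite !inE SX SC orbT.
have sidesT : {in sides, forall A, weakly_separated A T}.
  move=> A As; apply: wsT; rewrite !inE (sidesC A As) andbT.
  by apply/orP; right; apply: contraNneq Xsides => <-.
by have /andP[] := diag T T3 sidesT TX TY.
Qed.

End Collections.

Lemma quad_cross e i s j t x y z :
    i < s -> s < j -> j < t -> [&& e != i, e != s, e != j & e != t] ->
    [&& x != y, x != z & y != z] ->
    ~~ cross [:: e; i; s] [:: x; y; z] -> ~~ cross [:: e; s; j] [:: x; y; z] ->
    ~~ cross [:: e; j; t] [:: x; y; z] -> ~~ cross [:: e; i; t] [:: x; y; z] ->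
  (cross [:: e; i; j] [:: x; y; z] ->
    [&& [|| e == x, e == y | e == z], [|| s == x, s == y | s == z]
      & [|| t == x, t == y | t == z]]) /\
  (cross [:: e; s; t] [:: x; y; z] ->
    [&& [|| e == x, e == y | e == z], [|| i == x, i == y | i == z]
      & [|| j == x, j == y | j == z]]).
Proof. move=> is_ sj jt ne xyz c1 c2 c3 c4; split=> X; order_decide. Qed.

Lemma diagonals_cross e i s j t :
    i < s -> s < j -> j < t -> [&& e != i, e != s, e != j & e != t] ->
  cross [:: e; i; j] [:: e; s; t].
Proof. move=> is_ sj jt ne; order_decide. Qed.

Section Moves.
Variable n : nat.
Implicit Types (C D : {set {set 'I_n}}).

Section Quadrilateral.
Variables e i s j t : 'I_n.
Hypotheses (is_lt : i < s) (sj_lt : s < j)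
  (jt_lt : j < t) (e_out : [&& e != i, e != s, e != j & e != t]).

Definition quad_sides : seq {set 'I_n} :=
  [:: [set e; i; s]; [set e; s; j]; [set e; j; t]; [set e; i; t]].

Lemma quad_diagonals (T : {set 'I_n}) : #|T| = 3 ->
    {in quad_sides, forall S, weakly_separated S T} ->
    T != [set e; i; j] -> T != [set e; s; t] ->
  weakly_separated [set e; i; j] T && weakly_separated [set e; s; t] T.
Proof.
move=> T3 sidesT; have [x [y [z [neq TE]]]] := card3_set3 T3.
have side S : S \in quad_sides -> weakly_separated S [set x; y; z].
  by rewrite -TE; apply: sidesT.
have sub (a b c : 'I_n) : #|[set a; b; c]| = 3 ->
  [&& [|| a == x, a == y | a == z], [|| b == x, b == y | b == z]
    & [|| c == x, c == y | c == z]] -> T = [set a; b; c].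
  move=> abc3 abcT; apply/esym/eqP; rewrite eqEcard T3 abc3 leqnn andbT.
  apply/subsetP => u; rewrite TE !inE -!orbA.
  by move=> /or3P[]/eqP->; case/and3P: abcT.
have [d1 d2] := @quad_cross e i s j t x y z is_lt sj_lt jt_lt e_out neq
  ltac:(by rewrite -ws_triple side ?inE ?eqxx ?orbT)
  ltac:(by rewrite -ws_triple side ?inE ?eqxx ?orbT)
  ltac:(by rewrite -ws_triple side ?inE ?eqxx ?orbT)
  ltac:(by rewrite -ws_triple side ?inE ?eqxx ?orbT).
case/and4P: e_out => ei es ej et.
have ij : i != j by rewrite -val_eqE /= ltn_eqF // (ltn_trans is_lt).
have st : s != t by rewrite -val_eqE /= ltn_eqF // (ltn_trans sj_lt).
move=> TX TY; rewrite TE !ws_triple; apply/andP; split; apply/negP => X.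
  case/eqP: TY; apply: sub; first by rewrite card_set3 // es et.
  exact: d1.
case/eqP: TX; apply: sub; first by rewrite card_set3 // ei ej.
exact: d2.
Qed.

Lemma diagonals_crossing :
  weakly_separated [set e; i; j] [set e; s; t] = false.
Proof. by rewrite ws_triple diagonals_cross. Qed.

Lemma diagonals_not_sides :
  ([set e; i; j] \notin quad_sides) * ([set e; s; t] \notin quad_sides).
Proof.
move: e_out; rewrite -!val_eqE /= => out.
split; apply/negP; rewrite !inE => /or4P[] /eqP/setP E.
1-4: by have := E s; have := E t; rewrite !inE -!val_eqE /=; lia.
all: by have := E i; have := E j; rewrite !inE -!val_eqE /=; lia.
Qed.

Variable C : {set {set 'I_n}}.
Hypotheses (maxC : max_ws_collection 3 C) (sidesC : {subset quad_sides <= C}).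

Lemma flip_max :
  ([set e; i; j] \in C -> max_ws_collection 3
     ([set e; s; t] |: (C :\ [set e; i; j]))) /\
  ([set e; s; t] \in C -> max_ws_collection 3
     ([set e; i; j] |: (C :\ [set e; s; t]))).
Proof.
have [/negPf ij st] : i != j /\ s != t by rewrite -!val_eqE /=; split; lia.
case/and4P: (e_out) => ei es ej et.
have [X3 Y3] : #|[set e; i; j]| = 3 /\ #|[set e; s; t]| = 3.
  by rewrite !card_set3 // ?es ?et // ei ej ij.
split=> XC.
  apply: (@replace_max _ _ _ _ quad_sides maxC XC) => //.
  - by rewrite diagonals_crossing.
  - by rewrite diagonals_not_sides.
  exact: quad_diagonals.
apply: (@replace_max _ _ _ _ quad_sides maxC XC) => //.
- by rewrite weakly_separatedC diagonals_crossing.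
- by rewrite diagonals_not_sides.
by move=> T T3 sidesT TY TX; rewrite andbC quad_diagonals.
Qed.

End Quadrilateral.

Lemma move24_spec C D : move24 3 C D <-> exists e i s j t : 'I_n,
  [/\ max_ws_collection 3 C, [&& i < s, s < j & j < t],
      [&& e != i, e != s, e != j & e != t],
      {subset quad_sides e i s j t <= C} &
      [set e; i; j] \in C /\ D = [set e; s; t] |: (C :\ [set e; i; j]) \/
      [set e; s; t] \in C /\ D = [set e; i; j] |: (C :\ [set e; s; t])].
Proof.
split.
  case/andP=> maxC /existsP[I /existsP[i /existsP[s /existsP[j /existsP[t]]]]].
  case/and5P=> order out cardI /and4P[c1 c2 c3 c4] alt.
  have /cards1P[e IE] : #|I| == 1 by rewrite -(eqn_add2r 2).
  move: out; rewrite {I cardI}IE in c1 c2 c3 c4 alt *.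
  rewrite sub1set !inE -!orbA !negb_or => out.
  rewrite !setUA in c1 c2 c3 c4 alt.
  exists e, i, s, j, t; split=> //.
  - by case/and4P: out => -> -> -> ->.
  - by move=> S; rewrite !inE => /or4P[]/eqP->.
  by case/orP: alt => /andP[? /eqP]; [left|right].
case=> e [i [s [j [t [maxC order out sidesC alt]]]]].
have side S : S \in quad_sides e i s j t -> S \in C by apply: sidesC.
have [c1 c2 c3 c4] := And4 (side [set e; i; s] ltac:(by rewrite !inE eqxx))
  (side [set e; s; j] ltac:(by rewrite !inE eqxx ?orbT))
  (side [set e; j; t] ltac:(by rewrite !inE eqxx ?orbT))
  (side [set e; i; t] ltac:(by rewrite !inE eqxx ?orbT)).
apply/andP; split=> //; apply/existsP; exists [set e].
apply/existsP; exists i; apply/existsP; exists s; apply/existsP; exists j.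
apply/existsP; exists t; rewrite !setUA order cards1 sub1set !inE.
rewrite -!orbA !negb_or /= c1 c2 c3 c4 /=; apply/andP; split.
  by case/and4P: out => -> -> -> ->.
by case: alt => -[-> ->]; rewrite eqxx ?orbT.
Qed.

Lemma move24_max C D : move24 3 C D -> max_ws_collection 3 D.
Proof.
case/move24_spec=> e [i [s [j [t [maxC /and3P[is_lt sj_lt jt_lt] out sidesC]]]]].
have [m1 m2] := flip_max is_lt sj_lt jt_lt out maxC sidesC.
by case=> -[XC ->]; [apply: m1|apply: m2].
Qed.

Lemma move24_sym : symmetric (@move24 n 3).
Proof.
suff sym C D : move24 3 C D -> move24 3 D C.
  by move=> C D; apply/idP/idP; apply: sym.
move=> CD; have maxD := move24_max CD.
case/move24_spec: CD => e [i [s [j [t [maxC order out sidesC alt]]]]].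
have /and3P[is_lt sj_lt jt_lt] := order.
have nXY := diagonals_crossing is_lt sj_lt jt_lt out.
have [nX nY] := diagonals_not_sides is_lt sj_lt jt_lt out.
have [_ ws _] := (max_wsP C).1 maxC.
apply/move24_spec; exists e, i, s, j, t; split=> //.
  move=> S SQ; case: alt => -[XC ->]; rewrite !inE sidesC // andbT;
    apply/orP; right.
    by apply: contraNneq nX => <-.
  by apply: contraNneq nY => <-.
case: alt => -[XC ->]; [right|left]; rewrite setU11 setU1K ?setD1K //.
  by rewrite !inE negb_and; apply/orP; right; apply: contraFN nXY => YC; apply: ws.
by rewrite !inE negb_and; apply/orP; right; apply: contraFN nXY => YC; apply: ws.
Qed.

End Moves.

(** * Removing the points one by one *)

(** For a < b < c: {a, b, c} is an interval of the cyclically ordered set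
    {0, ..., c}. *)
Definition cyclic_interval (a b c : nat) : bool :=
  [|| (a == 0) && (b == 1), (a == 0) && (b == c.-1)
    | (a == c.-2) && (b == c.-1)].

Lemma interval_noncrossing x y z a b c :
    x < y -> y < z -> cyclic_interval x y z -> a <= z -> b <= z -> c <= z ->
  ~~ cross [:: a; b; c] [:: x; y; z].
Proof.
move=> xy yz; rewrite /cyclic_interval => xyz az bz cz.
have z1 : z.-1.+1 = z by lia.
have z2 : z.-2.+1 = z.-1 by lia.
have A t : (t <= 0) || ~~ (t < 1) by apply: adjacent.
have [Aa Ab Ac] := And3 (A a) (A b) (A c).
have [a0 b0 c0] := And3 (leq0n a) (leq0n b) (leq0n c).
have B t : (t <= z.-1) || ~~ (t < z) by apply: adjacent.
have [Ba Bb Bc] := And3 (B a) (B b) (B c).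
have D t : (t <= z.-2) || ~~ (t < z.-1) by apply: adjacent.
have [Da Db Dc] := And3 (D a) (D b) (D c).
have {z1 z2} z2 : z.-2 < z.-1 by rewrite -z2.
order_decide.
Qed.

Section Reduction.
Variable n : nat.
Implicit Types (C D : {set {set 'I_n}}).

(** The triples with a point m or beyond are as few as possible: they are cyclic
    intervals once the points after their last point are removed. *)
Definition reduced (m : nat) C : Prop := forall a b c,
  triples C a b c -> a < b -> b < c -> m <= c -> cyclic_interval a b c.

(** A cyclic interval crosses no triple whose points do not exceed its last
    point; hence the removed triples do not restrict those on the first m
    points. *)
Lemma restrict_system m C : max_ws_collection 3 C -> reduced m C -> m <= n ->
  max_system m (fun a b c => [&& a < m, b < m, c < m & triples C a b c]).
Proof.
move=> /triples_system sysC redC le_mn; split.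
- by move=> a b c; rewrite (sysC12 sysC) andbCA.
- by move=> a b c; rewrite (sysC23 sysC) (andbCA (b < m)).
- by move=> a b c /and4P[].
- by move=> a b c /and4P[_ _ _ /(sys_neq sysC)].
- move=> a b c x y z /and4P[_ _ _ Ca] /and4P[_ _ _ Cx].
  exact: (sys_nc sysC Ca Cx).
move=> a b c lta ltb ltc neq nc; rewrite lta ltb ltc /=.
have ltn_le a0 : a0 < m -> a0 < n by move=> lt; apply: leq_trans le_mn.
apply: (sys_max sysC); rewrite ?ltn_le //.
move=> x y z Cxyz; have [x' [y' [z' [xy yz Cx' E]]]] := sys_sort sysC Cxyz.
rewrite -(cross_eq_mem E (fun=> erefl)); have [zm|mz] := ltnP z' m.
  have ym := ltn_trans yz zm.
  by apply: nc; rewrite zm Cx' ym (ltn_trans xy ym).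
have xyz_ends := redC _ _ _ Cx' xy yz mz.
rewrite crossC interval_noncrossing //; exact: ltnW (leq_trans _ mz).
Qed.

Definition degree (m : 'I_n) C := #|[set S in C | m \in S]|.

Lemma exchange_move (m : 'I_n) C :
    3 < m -> max_ws_collection 3 C -> reduced m.+1 C ->
    ~~ [forall a : 'I_n, forall b : 'I_n,
          triples C a b m && (a < b < m) ==> cyclic_interval a b m] ->
  exists D, [/\ move24 3 C D, reduced m.+1 D & degree m D < degree m C].
Proof.
move=> m_gt3 maxC redC; rewrite negb_forall => /existsP[a0].
rewrite negb_forall => /existsP[b0]; rewrite negb_imply.
case/andP=> /andP[Cab /andP[ltab ltbm]].
rewrite /cyclic_interval !negb_or !negb_and.
case/and3P=> nfirst nouter nlast.
have sysM := restrict_system maxC redC (ltn_ord m).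
have Mab : [&& a0 < m.+1, b0 < m.+1, m < m.+1 & triples C a0 b0 m].
  by rewrite Cab ltnSn !ltnS (ltnW ltbm) (ltnW (ltn_trans ltab ltbm)).
have [e [b [a [c [[ba ac cm] [Meb Mea Mec Meba Meac]]]]]] :=
  nontrivial_exchange sysM m_gt3 Mab ltab ltbm nfirst nouter nlast.
have em : e < m.
  case/and4P: Meb => e_le _ _ /triplesC23/(sys_neq (triples_system maxC)) em.
  by rewrite ltn_neqAle em -ltnS.
have [an bn] := (ltn_trans ac cm, ltn_trans ba (ltn_trans ac cm)).
pose o x (xm : x < m) := Ordinal (ltn_trans xm (ltn_ord m)).
pose E := o e em; pose A := o a an; pose B := o b bn; pose G := o c cm.
have {Meb} : triples C E B m by case/and4P: Meb.
have {Mea} : triples C E A m by case/and4P: Mea.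
have {Mec} : triples C E G m by case/and4P: Mec.
have {Meba} : triples C E B A by case/and4P: Meba.
have {Meac} : triples C E A G by case/and4P: Meac.
rewrite !triplesP => /andP[/and3P[EA EG AG] c1] /andP[/and3P[EB _ BA] c2].
case/andP=> /and3P[_ Em Gm] c3 /andP[_ c4] /andP[/and3P[_ _ Bm] c5].
exists ([set E; B; G] |: (C :\ [set E; A; m])); split.
- apply/move24_spec; exists E, B, A, G, m; split=> //.
  + by rewrite /= ba ac cm.
  + by rewrite EB EA EG Em.
  + by move=> S; rewrite !inE => /or4P[]/eqP->.
  by right.
- move=> a' b' c' /triples_ord[x [y [z [-> -> ->]]]]; rewrite triplesP in_setU1.
  case/andP=> neq /orP[/eqP/setP/(_ z)|]; last first.
    rewrite in_setD1 => /andP[_ xyzC]; apply: redC.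
    by rewrite triplesP neq.
  rewrite !inE eqxx orbT => /esym zEBG xy yz mz.
  have: z < m by case/orP: zEBG => [/orP[]|] /eqP->.
  by move/(leq_ltn_trans mz); rewrite ltnNge leqnSn.
have mX : m \in [set E; A; m] by rewrite !inE eqxx orbT.
have mY : m \notin [set E; B; G].
  by rewrite !inE !negb_or !(eq_sym m) Em Bm Gm.
rewrite /degree [X in _ < X](cardsD1 [set E; A; m]) inE c4 mX add1n ltnS.
apply/subset_leq_card/subsetP => S; rewrite !inE.
case/andP=> [/orP[/eqP->|/andP[-> ->]] //].
by rewrite (negPf mY).
Qed.

Lemma reduced_down (m : 'I_n) C : 2 < m -> reduced m.+1 C ->
  [forall a : 'I_n, forall b : 'I_n,
     triples C a b m && (a < b < m) ==> cyclic_interval a b m] ->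
  reduced m C.
Proof.
move=> m_gt2 redC all_ends a b c /triples_ord[x [y [z [-> -> ->]]]] Cxyz xy yz.
rewrite leq_eqVlt => /orP[/eqP/val_inj mz|mz]; last exact: redC Cxyz xy yz mz.
rewrite -mz in Cxyz yz *; move/forallP/(_ x)/forallP/(_ y): all_ends.
by rewrite Cxyz xy yz.
Qed.

(** Each exchange lowers the number of triples containing m, as the triple ebc
    that replaces eam consists of points before m. *)
Lemma reach_reduced_step (m : 'I_n) C :
    2 < m -> max_ws_collection 3 C -> reduced m.+1 C ->
  exists D, [/\ connect (@move24 n 3) C D, max_ws_collection 3 D & reduced m D].
Proof.
move=> m_gt2; move Ed: (degree m C) => d.
elim/ltn_ind: d C Ed => d IHd C Ed maxC redC.
have [/(reduced_down m_gt2 redC) red_m|not_ends] := boolP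
    [forall a : 'I_n, forall b : 'I_n,
       triples C a b m && (a < b < m) ==> cyclic_interval a b m].
  by exists C.
have [m_gt3|m_le3] := ltnP 3 m; last first.
  case/negP: not_ends; apply/forallP => a; apply/forallP => b.
  by apply/implyP=> /andP[_ /andP[ab bm]]; rewrite /cyclic_interval; lia.
have [D [CD redD]] := exchange_move m_gt3 maxC redC not_ends.
rewrite Ed => ltd; have maxD := move24_max CD.
have [D' [DD' maxD' redD']] := IHd _ ltd _ erefl maxD redD.
by exists D'; split=> //; apply: connect_trans (connect1 CD) DD'.
Qed.

Lemma reach_reduced k C : k + 3 <= n -> max_ws_collection 3 C ->
  exists D, [/\ connect (@move24 n 3) C D, max_ws_collection 3 D
               & reduced (n - k) D].
Proof.
move=> + maxC; elim: k => [|k IHk] le_kn.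
  exists C; split=> // a b c /triples_lt[_ _ ltc] _ _; rewrite subn0 => nc.
  by have := leq_ltn_trans nc ltc; rewrite ltnn.
have [|D [CD maxD redD]] := IHk; first by lia.
have lt_m : n - k.+1 < n by lia.
have [||D' [DD' maxD' redD']] := @reach_reduced_step (Ordinal lt_m) D _ maxD.
- by rewrite /=; lia.
- by rewrite /= subnSK //; lia.
by exists D'; split=> //; apply: connect_trans DD'.
Qed.

(** With three points left all triples are cyclic intervals, which never cross
    each other; by maximality each of the collections contains all of them. *)
Lemma reduced3_sub C D : max_ws_collection 3 C -> max_ws_collection 3 D ->
  reduced 3 C -> reduced 3 D -> C \subset D.
Proof.
move=> maxC maxD redC redD.
have [sysC sysD] := (triples_system maxC, triples_system maxD).
have red_interval B a b c : reduced 3 B -> triples B a b c ->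
    a < b -> b < c -> cyclic_interval a b c.
  move=> redB Babc ab bc; have [|c_lt3] := leqP 3 c; first exact: redB.
  by rewrite /cyclic_interval; lia.
have [C3 _ _] := (max_wsP C).1 maxC.
apply/subsetP => S SC; have [x [y [z [neq SE]]]] := card3_set3 (C3 S SC).
have Cxyz : triples C x y z by rewrite triplesP neq -SE.
suff: triples D x y z by rewrite triplesP neq -SE.
apply: (sys_max sysD) => // a b c Dabc.
have [x' [y' [z' [xy yz Cx' E]]]] := sys_sort sysC Cxyz.
have [a' [b' [c' [ab bc Da' E']]]] := sys_sort sysD Dabc.
rewrite -(cross_eq_mem E' E).
have xyz_interval := red_interval _ _ _ _ redC Cx' xy yz.
have abc_interval := red_interval _ _ _ _ redD Da' ab bc.
have [cz|/ltnW zc] := leqP c' z'.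
  apply: interval_noncrossing => //; apply: leq_trans cz => //.
    by rewrite ltnW // (ltn_trans ab).
  exact: ltnW.
by rewrite crossC; apply: interval_noncrossing => //; apply: leq_trans zc;
   rewrite ltnW // (ltn_trans xy).
Qed.

End Reduction.

Theorem theorem5 (n : nat) (C B : {set {set 'I_n}}) :
  3 <= n ->
  max_ws_collection 3 C ->
  max_ws_collection 3 B ->
  exists moves : seq {set {set 'I_n}},
    path (@move24 n 3) C moves /\ last C moves = B.
Proof.
move=> n_ge3 maxC maxB.
have [|C' [CC' maxC']] := @reach_reduced n (n - 3) C _ maxC; first by lia.
have [|B' [BB' maxB']] := @reach_reduced n (n - 3) B _ maxB; first by lia.
rewrite subKn // => redB redC.
have eqCB : C' = B' by apply/eqP; rewrite eqEsubset !reduced3_sub.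
have: connect (@move24 n 3) C B.
  apply: connect_trans CC' _; rewrite eqCB.
  by rewrite (sym_connect_sym (@move24_sym n)).
by case/connectP=> moves pathC BE; exists moves.
Qed.
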